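(* Assume $n\ge2$. Let $D\subset\mathbb{C}^n$ be a domain and let $K\subset D$ be a compact set such that $D\setminus K$ is connected. If $f\in\mathcal{SR}(\Omega_{D\setminus K},\mathbb{O})$, then there is a function $g\in\mathcal{SR}(\Omega_D,\mathbb{O})$ such that $g|_{\Omega_{D\setminus K}}=f$.
   Context: $\mathbb{O}$ denotes the (nonassociative, alternative) algebra of octonions, $\mathbb{S}=\{a\in\mathbb{O}: a^2=-1\}$. For $J\in\mathbb{S}$, $\mathbb{C}_J=\mathbb{R}+J\mathbb{R}\subset\mathbb{O}$ and $\mathbb{C}_J^n=(\mathbb{C}_J)^n$; $\mathbb{O}_s^n=\bigcup_{J\in\mathbb{S}}\mathbb{C}_J^n\subset\mathbb{O}^n$. The complexification is $\mathbb{O}_{\mathbb{C}}=\mathbb{O}\otimes_{\mathbb{R}}\mathbb{C}=\{x+iy: x,y\in\mathbb{O}\}$, $i^2=-1$, with product $(x+iy)(u+iv)=xu-yv+i(xv+yu)$ and complex conjugation $\overline{x+iy}=x-iy$; its complex structure is left multiplication by $i$. For any open $D\subset\mathbb{C}^n$: $\overline{z}$ is the componentwise conjugate and $\mathrm{conj}(D)=\{z\in\mathbb{C}^n:\overline{z}\in D\}$. A function $F=F_1+iF_2:D\to\mathbb{O}_{\mathbb{C}}$ ($F_1,F_2$ being $\mathbb{O}$-valued) is an $\mathbb{O}$-stem function if $F(\overline{z})=\overline{F(z)}$ for $z\in D$; if $D$ is not invariant under conjugation, the condition is required whenever $z,\overline{z}\in D$, and $F$ is extended to $D\cup\mathrm{conj}(D)$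 by this formula. Put $\Omega_D=\{\alpha+\beta J\in\mathbb{C}_J^n: J\in\mathbb{S},\ \alpha,\beta\in\mathbb{R}^n,\ \alpha+i\beta\in D\}\subset\mathbb{O}_s^n$. A stem function $F$ induces the (left) slice function $f=\mathcal{I}(F):\Omega_D\to\mathbb{O}$, $f(\alpha+\beta J)=F_1(\alpha+i\beta)+JF_2(\alpha+i\beta)$ (well defined). $\mathcal{SR}(\Omega_D,\mathbb{O})$ (the slice regular functions) is the set of $\mathcal{I}(F)$ with $F$ a $C^1$ stem function that is holomorphic, i.e. $\frac{\partial F}{\partial\overline{z}_t}=\frac12\big(\frac{\partial F}{\partial\alpha_t}+i\frac{\partial F}{\partial\beta_t}\big)=0$ for all $t=1,\dots,n$, where $z_t=\alpha_t+i\beta_t$. *)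

(* Defs.v *)
From mathcomp Require Import all_boot all_order all_algebra.
From mathcomp Require Import all_classical all_reals all_analysis.

Set Implicit Arguments.
Unset Strict Implicit.
Unset Printing Implicit Defensive.

Import Order.TTheory GRing.Theory Num.Theory.
Import numFieldNormedType.Exports.

Local Open Scope classical_set_scope.
Local Open Scope ring_scope.

(* Cayley-Dickson doubling of an algebra A with product m and involution c. *)
Definition cd_mul (A : zmodType) (m : A -> A -> A) (c : A -> A) (x y : A * A)
  : A * A :=
  (m x.1 y.1 - m (c y.2) x.2, m y.2 x.1 + m x.2 (c y.1)).

Definition cd_conj (A : zmodType) (c : A -> A) (x : A * A) : A * A :=
  (c x.1, - x.2).

(* The octonions are the third double of the reals. Being nested products of
   R^o, their additive group, real scaling and topology are those of R^8. *)
Definition cd1 (R : realType) := (R^o * R^o)%type.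
Definition cd2 (R : realType) := (cd1 R * cd1 R)%type.
Definition oct (R : realType) := (cd2 R * cd2 R)%type.

Definition cd1_mul (R : realType) : cd1 R -> cd1 R -> cd1 R :=
  cd_mul (fun x y : R^o => x * y) id.
Definition cd1_conj (R : realType) : cd1 R -> cd1 R :=
  cd_conj (A := R^o) id.
Definition cd2_mul (R : realType) : cd2 R -> cd2 R -> cd2 R :=
  cd_mul (@cd1_mul R) (@cd1_conj R).
Definition cd2_conj (R : realType) : cd2 R -> cd2 R :=
  cd_conj (@cd1_conj R).
Definition oct_mul (R : realType) : oct R -> oct R -> oct R :=
  cd_mul (@cd2_mul R) (@cd2_conj R).

Definition oct_one (R : realType) : oct R := (((1, 0), 0), 0).

Definition oct_sphere (R : realType) : set (oct R) :=
  [set a | oct_mul a a = - oct_one R].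

(* C^n, the pair (alpha, beta) standing for z = alpha + i beta. *)
Definition Cspace (R : realType) (n : nat) := ('rV[R]_n * 'rV[R]_n)%type.

Definition Cspace_conj (R : realType) (n : nat) (z : Cspace R n) : Cspace R n :=
  (z.1, - z.2).

Definition domain (R : realType) (n : nat) (D : set (Cspace R n)) : Prop :=
  [/\ D !=set0, open D & connected D].

(* The complexified octonions, the pair (x, y) standing for x + i y. *)
Definition octC (R : realType) := (oct R * oct R)%type.

Definition octC_mul (R : realType) (w v : octC R) : octC R :=
  (oct_mul w.1 v.1 - oct_mul w.2 v.2, oct_mul w.1 v.2 + oct_mul w.2 v.1).

Definition octC_i (R : realType) : octC R := (0, oct_one R).

Definition octC_conj (R : realType) (w : octC R) : octC R := (w.1, - w.2).

(* alpha + beta J, componentwise *)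
Definition slice_point (R : realType) (n : nat) (J : oct R) (z : Cspace R n)
  : 'rV[oct R]_n :=
  \row_t (z.1 0 t *: oct_one R + z.2 0 t *: J).

Definition Omega (R : realType) (n : nat) (D : set (Cspace R n))
  : set 'rV[oct R]_n :=
  [set x | exists J, exists z, [/\ oct_sphere J, D z & x = slice_point J z]].

(* Only the values of F on D matter; when D is not invariant under conjugation,
   the condition is required only where both sides are given. *)
Definition stem (R : realType) (n : nat) (D : set (Cspace R n))
  (F : Cspace R n -> octC R) : Prop :=
  forall z, D z -> D (Cspace_conj z) -> F (Cspace_conj z) = octC_conj (F z).

(* f = I(F) on Omega D; f is unconstrained elsewhere. Quantifying over z in D
   also covers the extension of F to conj(D): replacing (z, J) by (conj z, - J)
   changes neither slice_point J z nor F_1(z) + J F_2(z). *)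
Definition slice_induced (R : realType) (n : nat) (D : set (Cspace R n))
  (F : Cspace R n -> octC R) (f : 'rV[oct R]_n -> oct R) : Prop :=
  forall J z, oct_sphere J -> D z ->
    f (slice_point J z) = (F z).1 + oct_mul J (F z).2.

Definition dir_alpha (R : realType) (n : nat) (t : 'I_n) : Cspace R n :=
  (delta_mx 0 t, 0).
Definition dir_beta (R : realType) (n : nat) (t : 'I_n) : Cspace R n :=
  (0, delta_mx 0 t).

(* The real partial derivatives of F exist and are continuous on the open set
   D. *)
Definition C1_on (R : realType) (n : nat) (D : set (Cspace R n))
  (F : Cspace R n -> octC R) : Prop :=
  forall t v, v = dir_alpha R t \/ v = dir_beta R t ->
    forall z, D z ->
      derivable F z v /\ {for z, continuous (fun w => 'D_v F w)}.

Definition dbar (R : realType) (n : nat) (t : 'I_n)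
  (F : Cspace R n -> octC R) (z : Cspace R n) : octC R :=
  2^-1 *: ('D_(dir_alpha R t) F z
           + octC_mul (octC_i R) ('D_(dir_beta R t) F z)).

Definition holomorphic_on (R : realType) (n : nat) (D : set (Cspace R n))
  (F : Cspace R n -> octC R) : Prop :=
  C1_on D F /\ forall t z, D z -> dbar t F z = 0.

(* Membership of (the restriction to Omega D of) f in SR(Omega D, O). *)
Definition slice_regular (R : realType) (n : nat) (D : set (Cspace R n))
  (f : 'rV[oct R]_n -> oct R) : Prop :=
  exists F : Cspace R n -> octC R,
    [/\ stem D F, holomorphic_on D F & slice_induced D F f].

(* Main.v *)
(* The stem symmetry extends F holomorphically to the union W of D \ K and its
   conjugate; let E be the union of D and its conjugate. Take a C^2 cutoff chi,
   equal to 1 near K and its conjugate and supported in E. The form F dbar(chi),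
   extended by zero, is dbar-closed with bounded support, and
   dbar v = F dbar(chi) is solved by a Cauchy transform in one coordinate; in
   polar coordinates about the evaluation point the kernel is not singular, so
   that only continuous functions are integrated, over rectangles. Then
   (1 - chi) F + v is holomorphic on E. Since n >= 2, v vanishes where the real
   part of a second coordinate exceeds all its values on the support of chi, so
   the extension equals F there. Averaging it with its conjugate makes it a stem
   function. By the identity theorem it equals F on the connected set D \ K.
   The identity theorem is proved along complex lines: if h vanishes near the
   centre of a disc, the Cauchy formula applied to h / z^m, with m -> oo, shows
   that h vanishes on a disc of definite size. *)

From HB Require Import structures.
Require Import Defs.
From mathcomp Require Import all_boot all_order all_algebra finmap.
From mathcomp Require Import all_classical all_reals all_analysis.
From mathcomp Require Import ring lra.

Set Implicit Arguments.
Unset Strict Implicit.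
Unset Printing Implicit Defensive.

Import Order.TTheory GRing.Theory Num.Theory.
Import numFieldNormedType.Exports.

Local Open Scope classical_set_scope.
Local Open Scope ring_scope.

(** * Calculus preliminaries *)

(** The stem condition shapes the argument. [D] need not be invariant under conjugation, and a point
    of [K] may have its conjugate in D minus K, where [F] is prescribed; an extension over [D] alone
    would not visibly respect the stem condition there. On [E] the problem is symmetric, and
    averaging makes sense because [E] contains the conjugates of its points. The region of agreement
    is cut out by a real part because conjugation preserves it: a point of the region in the
    conjugate of [D] yields one in [D]. Left multiplication by i only exchanges, up to sign, the two
    octonions of a value of [F], so holomorphy is a Cauchy-Riemann system for eight pairs of real
    functions, and the analysis is done for one pair [p], [q] standing for p + i q. A transform in
    one variable solves all the dbar equations: dbar_t moves under the integral, closedness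
    exchanges it for the derivative in the variable of integration, and Pompeiu's formula returns
    the t-th coefficient. The cutoff is C^2 so that these coefficients are C^1 and its second
    derivatives commute. *)

Section Continuity.
Context {S T U : topologicalType}.

Lemma cts_comp (f : S -> T) (g : T -> U) :
  continuous f -> continuous g -> continuous (fun x => g (f x)).
Proof. by move=> cf cg x; apply: continuous_comp; [exact: cf|exact: cg]. Qed.

Lemma cts_pair (f : S -> T) (g : S -> U) :
  continuous f -> continuous g -> continuous (fun x => (f x, g x)).
Proof. by move=> cf cg x; apply: cvg_pair; [exact: cf|exact: cg]. Qed.

Lemma cts_cst (u : U) : continuous (fun _ : T => u).
Proof. by move=> x; exact: cvg_cst. Qed.

Lemma cts_id : continuous (fun x : T => x).
Proof. by move=> x; exact: cvg_id. Qed.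

Lemma cts_fst : continuous (fun x : T * U => x.1).
Proof. by move=> x; exact: cvg_fst. Qed.

Lemma cts_snd : continuous (fun x : T * U => x.2).
Proof. by move=> x; exact: cvg_snd. Qed.

End Continuity.

Section RealContinuity.
Context {R : realType} {T : topologicalType}.
Implicit Types f g : T -> R.

Lemma ctsD f g : continuous f -> continuous g -> continuous (fun x => f x + g x).
Proof. by move=> cf cg x; apply: cvgD; [exact: cf|exact: cg]. Qed.

Lemma ctsB f g : continuous f -> continuous g -> continuous (fun x => f x - g x).
Proof. by move=> cf cg x; apply: cvgB; [exact: cf|exact: cg]. Qed.

Lemma ctsN f : continuous f -> continuous (fun x => - f x).
Proof. by move=> cf x; apply: cvgN; exact: cf. Qed.

Lemma ctsM f g : continuous f -> continuous g -> continuous (fun x => f x * g x).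
Proof. by move=> cf cg x; apply: cvgM; [exact: cf|exact: cg]. Qed.

End RealContinuity.

(** * Integrals over a segment, depending on a parameter *)

Definition intg (R : realType) (a b : R) (f : R -> R) : R :=
  (\int[@lebesgue_measure R]_(x in `[a, b]) f x)%R.

Section Intg.
Context {R : realType}.
Notation mu := (@lebesgue_measure R).

Lemma cts_integrable (a b : R) (f : R -> R) : continuous f ->
  mu.-integrable `[a, b] (EFin \o f).
Proof.
move=> cf; apply: continuous_compact_integrable; first exact: segment_compact.
exact: continuous_subspaceT.
Qed.

Lemma intg_FTC (a b : R) (F f : R -> R) : a <= b -> continuous f ->
  (forall x : R, is_derive x (1 : R) F (f x)) -> intg a b f = F b - F a.
Proof.
rewrite le_eqVlt => /predU1P[<-|ab] cf dF.
  by rewrite /intg set_itv1 Rintegral_set1 subrr.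
have cF : continuous F.
  by move=> x; apply/differentiable_continuous/derivable1_diffP.
rewrite /intg /Rintegral (@continuous_FTC2 _ _ F)//.
- exact: continuous_subspaceT.
- split=> //.
  + by apply: cvg_at_right_filter; exact: cF.
  + by apply: cvg_at_left_filter; exact: cF.
- by move=> x _; rewrite derive1E derive_val.
Qed.

Lemma eq_intg (a b : R) (f g : R -> R) :
  (forall x, a <= x <= b -> f x = g x) -> intg a b f = intg a b g.
Proof.
by move=> fg; apply: eq_Rintegral => x; rewrite inE/= in_itv/=; exact: fg.
Qed.

Lemma intgD (a b : R) (f g : R -> R) : continuous f -> continuous g ->
  intg a b (fun x => f x + g x) = intg a b f + intg a b g.
Proof. by move=> cf cg; apply: RintegralD => //; exact: cts_integrable. Qed.

Lemma intgZ (a b k : R) (f : R -> R) : continuous f ->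
  intg a b (fun x => k * f x) = k * intg a b f.
Proof. by move=> cf; apply: RintegralZl => //; exact: cts_integrable. Qed.

Lemma intgB (a b : R) (f g : R -> R) : continuous f -> continuous g ->
  intg a b (fun x => f x - g x) = intg a b f - intg a b g.
Proof. by move=> cf cg; apply: RintegralB => //; exact: cts_integrable. Qed.

Lemma intg_cst (a b k : R) : a <= b -> intg a b (fun=> k) = k * (b - a).
Proof.
move=> ab; rewrite /intg Rintegral_cst//= lebesgue_measure_itv/= lte_fin.
by move: ab; rewrite le_eqVlt => /predU1P[->|->]//=; rewrite ltxx subrr.
Qed.

Lemma intg_le_norm (a b M : R) (f : R -> R) : a <= b -> continuous f ->
  (forall x, a <= x <= b -> `|f x| <= M) -> `|intg a b f| <= M * (b - a).
Proof.
move=> ab cf fM.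
have cM : continuous (fun _ : R => M) by exact: cts_cst.
rewrite -intg_cst//; apply: le_trans (le_normr_Rintegral _ _) _ => //.
  exact: cts_integrable.
apply: le_Rintegral => //.
  by apply: cts_integrable => x; exact: cvg_norm (cf x).
exact: cts_integrable.
Qed.

Lemma intg_trunc (a b c : R) (f : R -> R) : a <= b <= c -> continuous f ->
  (forall x, b <= x -> f x = 0) -> intg a c f = intg a b f.
Proof.
move=> /andP[ab bc] cf f0; apply/eqP; rewrite -subr_eq0; apply/eqP.
rewrite /intg Rintegral_itvB//; last exact: cts_integrable.
rewrite (@eq_Rintegral _ _ _ _ _ (fun=> 0)) ?Rintegral_cst ?mul0r//.
by move=> x; rewrite inE/= in_itv/= => /andP[/ltW bx _]; exact: f0.
Qed.

(** Tube argument: compactness of the segment turns continuity at each point [(x0, t)] into one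
    neighbourhood of [x0] that serves all [t]. As [T] is any topological space, a product with [R]
    is allowed, which double integrals require. *)
Lemma unif_near (T : topologicalType) (a b : R) (f : T * R -> R) (x0 : T)
    (e : R) : continuous f -> 0 < e ->
  \forall x \near x0, forall t, a <= t <= b -> `|f (x, t) - f (x0, t)| <= e.
Proof.
move=> cf e0.
have /compact_near_coveringP nc : compact `[a, b] by exact: segment_compact.
suff /(nc T (nbhs x0) (fun x t => `|f (x, t) - f (x0, t)| <= e) _) :
  forall t : R, [set` `[a, b]] t -> \forall t' \near t & x \near nbhs x0,
    `|f (x, t') - f (x0, t')| <= e.
  by apply: filterS => x + t tab; apply => /=; rewrite in_itv.
move=> t _.
have e2 : 0 < e / 2 by rewrite divr_gt0.
have /cvgrPdist_le/(_ _ e2) [[A B] /= [nA nB] AB] := cf (x0, t).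
exists (B, A) => //= -[t' x'] /= [Bt Ax].
have h1 : `|f (x0, t) - f (x', t')| <= e / 2 by exact: (AB (x', t')).
have h2 : `|f (x0, t) - f (x0, t')| <= e / 2.
  by apply: (AB (x0, t')); split => //=; exact: nbhs_singleton nA.
rewrite (splitr e) -(subrK (f (x0, t)) (f (x', t'))) -addrA.
by rewrite (le_trans (ler_normD _ _))// lerD// distrC.
Qed.

Lemma cts_section (T : topologicalType) (f : T * R -> R) (x : T) :
  continuous f -> continuous (fun t => f (x, t)).
Proof.
move=> cf; apply: (@cts_comp _ _ _ (fun t => (x, t))) => //; apply: cts_pair.
  exact: cts_cst.
exact: cts_id.
Qed.

Lemma intg_continuous (T : topologicalType) (a b : R) (f : T * R -> R) :
  a <= b -> continuous f -> continuous (fun x => intg a b (fun t => f (x, t))).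
Proof.
move=> ab cf x0; apply/cvgrPdist_le => e e0.
(* The summand 1 keeps the denominator positive when [a = b]. *)
have e1 : 0 < e / (b - a + 1) by rewrite divr_gt0//; lra.
have := unif_near a b x0 cf e1; apply: filterS => x fx.
have c1 := cts_section (x := x) cf; have c0 := cts_section (x := x0) cf.
rewrite distrC -intgB//; apply: le_trans (intg_le_norm ab _ fx) _.
  exact: ctsB.
rewrite mulrAC ler_pdivrMr; last by lra.
by rewrite ler_pM2l//; lra.
Qed.

(** The mean value theorem along a line. Only derivability in the direction [v] is assumed, so it
    serves functions known through their partial derivatives; [h] may be negative, hence the bound
    on the absolute value of [s]. *)
Lemma line_MVT (X : normedModType R) (f : X -> R) (x v : X) (h : R) :
  (forall s : R, `|s| <= `|h| -> derivable f (x + s *: v) v) ->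
  exists2 s : R, `|s| <= `|h| &
    f (x + h *: v) - f x = h * 'D_v f (x + s *: v).
Proof.
move=> df; pose g (s : R) := f (x + s *: v).
have dg (s : R) : `|s| <= `|h| -> is_derive s (1 : R) g ('D_v f (x + s *: v)).
  move=> sh; have dfs := df s sh.
  have E : (fun k : R => k^-1 *: ((g \o shift s) (k *: (1 : R)) - g s)) =
           (fun k : R => k^-1 *: ((f \o shift (x + s *: v)) (k *: v) - f (x + s *: v))).
    apply/funext => k; rewrite /g /=; congr (_ *: (f _ - _)).
    by rewrite scalerDl -scalerA scale1r addrCA addrC -addrA [s *: v + _]addrC addrA addrC addrA.
  by split; [rewrite /derivable E|rewrite /derive E].
have g0 : g 0 = f x by rewrite /g scale0r addr0.
have cg (a b : R) : (forall s : R, a <= s <= b -> `|s| <= `|h|) ->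
    {within `[a, b], continuous g}.
  move=> ab; apply: derivable_within_continuous => s; rewrite in_itv/= => /ab.
  by move/dg => ?.
have [h0|h0] := leP 0 h.
  have hh (s : R) : 0 <= s <= h -> `|s| <= `|h|.
    by move=> /andP[s0 sh]; rewrite !ger0_norm.
  have [|s] := MVT_segment h0 _ (cg _ _ hh) (df := fun s => 'D_v f (x + s *: v)).
    by move=> s; rewrite in_itv/= => /andP[s0 sh]; apply: dg; rewrite hh// !ltW.
  rewrite in_itv/= => /hh sh; rewrite g0 subr0 => E.
  by exists s => //; rewrite mulrC; exact: E.
have hh (s : R) : h <= s <= 0 -> `|s| <= `|h|.
  by move=> /andP[sh s0]; rewrite !ler0_norm ?lerN2// ltW.
have [|s] := MVT_segment (ltW h0) _ (cg _ _ hh) (df := fun s => 'D_v f (x + s *: v)).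
  by move=> s; rewrite in_itv/= => /andP[s0 sh]; apply: dg; rewrite hh// !ltW.
rewrite in_itv/= => /hh sh; rewrite g0 sub0r mulrN => E.
by exists s => //; rewrite mulrC; apply: oppr_inj; rewrite opprB; exact: E.
Qed.

(** The mean value theorem replaces each difference quotient by a value of [f'] at a point near
    [x0], and [unif_near] bounds the error uniformly in [t]. *)
Lemma intg_is_derive (X : normedModType R) (a b : R) (f f' : X * R -> R)
    (x0 v : X) : a <= b -> continuous f -> continuous f' ->
  (forall x t, is_derive x v (fun x => f (x, t)) (f' (x, t))) ->
  is_derive x0 v (fun x => intg a b (fun t => f (x, t)))
    (intg a b (fun t => f' (x0, t))).
Proof.
move=> ab cf cf' df.
set I := fun x => intg a b _; set I' := intg a b _.
suff L : (fun h : R => h^-1 *: ((I \o shift x0) (h *: v) - I x0)) @ 0^' --> I'.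
  by split; [apply/cvg_ex; exists I'|exact: cvg_lim].
apply/cvgrPdist_le => e e0.
have e1 : 0 < e / (b - a + 1) by rewrite divr_gt0//; lra.
have /nbhs_ballP[d /= d0 dP] := unif_near a b x0 cf' e1.
(* Chosen so that [h *: v] is shorter than [d]; the summand 1 covers [v = 0]. *)
have [k k0 kv] : exists2 k, 0 < k & k * `|v| < d.
  exists (d / (`|v| + 1)); first by rewrite divr_gt0// ltr_wpDl.
  have v0 := normr_ge0 v.
  by rewrite mulrAC ltr_pdivrMr ?ltr_pM2l//; lra.
near=> h.
have h0 : h != 0 by near: h; exact: nbhs_dnbhs_neq.
have hk : `|h| < k by near: h; apply: dnbhs0_lt.
have c1 y : continuous (fun t => f (y, t)) by exact: cts_section.
have c1' y : continuous (fun t => f' (y, t)) by exact: cts_section.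
have -> : h^-1 *: ((I \o shift x0) (h *: v) - I x0) =
    intg a b (fun t => h^-1 * (f (h *: v + x0, t) - f (x0, t))).
  by rewrite intgZ ?intgB//; exact: ctsB.
have c2 : continuous (fun t => h^-1 * (f (h *: v + x0, t) - f (x0, t))).
  by apply: ctsM; [exact: cts_cst|exact: ctsB].
rewrite -intgB//; apply: le_trans (intg_le_norm (M := e / (b - a + 1)) ab _ _) _.
- exact: ctsB.
- move=> t tab.
  have [s _|s sh] := @line_MVT X (fun x => f (x, t)) x0 v h.
    by have [] := df (x0 + s *: v) t.
  rewrite [x0 + h *: v]addrC => ->; rewrite mulKf// distrC.
  have [_ ->] := df (x0 + s *: v) t.
  apply: dP => //; rewrite -ball_normE /ball_/= opprD addNKr normrN normrZ.
  by apply: le_lt_trans kv; rewrite ler_wpM2r// (le_trans sh)// ltW.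
rewrite mulrAC ler_pdivrMr; last by lra.
by rewrite ler_pM2l//; lra.
Unshelve. all: by end_near. Qed.

End Intg.

(** * Derivatives as properties of germs *)

Lemma near_cts (S T : topologicalType) (f g : S -> T) (z : S) :
  (\forall w \near z, f w = g w) ->
  {for z, continuous f} -> {for z, continuous g}.
Proof.
move=> fg cf; rewrite /prop_for /continuous_at -(nbhs_singleton fg).
by apply: cvg_trans cf; apply: near_eq_cvg.
Qed.

Section Derive.
Context {R : realType} {X : normedModType R}.

Lemma near_derive (A : normedModType R) (f g : X -> A) (z v : X) :
  (\forall w \near z, f w = g w) ->
  'D_v f z = 'D_v g z /\ (derivable f z v -> derivable g z v).
Proof.
move=> fg.
have E : \forall h \near 0^', h^-1 *: ((f \o shift z) (h *: v) - f z) =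
                              h^-1 *: ((g \o shift z) (h *: v) - g z).
  have c : h *: v + z @[h --> (0 : R)] --> z.
    rewrite -[X in _ --> X]add0r -(scale0r v).
    by apply: cvgD; [apply: cvgZr_tmp; exact: cvg_id|exact: cvg_cst].
  have := c _ fg; rewrite /= => fg'.
  apply: cvg_within; near=> h; rewrite /= (nbhs_singleton fg); congr (_ *: (_ - _)).
  by near: h; exact: fg'.
split.
  rewrite /derive; congr lim; apply/seteqP; split; apply: near_eq_cvg => //.
  by apply: filterS E => h ->.
move=> /cvg_ex[l fl]; apply/cvg_ex; exists l; apply: cvg_trans fl.
exact: near_eq_cvg.
Unshelve. all: by end_near. Qed.

Lemma differentiable_of (f : X -> R) (x : X) (L : {linear X -> R}) :
  continuous L ->
  (forall e, 0 < e ->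
     \forall h \near (0 : X), `|f (h + x) - f x - L h| <= e * `|h|) ->
  differentiable f x.
Proof.
move=> cL fL.
have E : f \o shift x = cst (f x) + L +o_ 0 id.
  apply/eqaddoP => e e0; have := fL e e0; apply: filterS => h.
  by rewrite /= opprD addrA.
by apply/diff_locallyP; rewrite (diff_unique cL E).
Qed.

Lemma near_differentiable (f g : X -> R) (z : X) :
  (\forall w \near z, f w = g w) -> differentiable f z -> differentiable g z.
Proof.
move=> fg df; apply: (@differentiable_of _ _ ('d f z)).
  exact: diff_continuous.
move=> e e0.
have [_ /eqaddoP/(_ e e0) H] := (diff_locallyP _ _).1 df.
have c : h + z @[h --> (0 : X)] --> z.
  by rewrite -[X in _ --> X]add0r; apply: cvgD; [exact: cvg_id|exact: cvg_cst].
have := c _ fg; rewrite /= => fg'.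
near=> h.
have <- : f (h + z) = g (h + z) by near: h; exact: fg'.
rewrite -(nbhs_singleton fg).
have : `|(f \o shift z - (cst (f z) + 'd f z)) h| <= e * `|h| by near: h; exact: H.
by rewrite !fctE opprD addrA.
Unshelve. all: by end_near. Qed.

Lemma derive_lin (f : X -> R) (z v w : X) (a b : R) : differentiable f z ->
  'D_(a *: v + b *: w) f z = a * 'D_v f z + b * 'D_w f z.
Proof. by move=> df; rewrite !deriveE// linearD !linearZ. Qed.

End Derive.

(** Differentiability is asked near [z], continuity of the derivatives only at [z]. The property
    depends on the germ alone, so a product with a cutoff can be treated point by point: by algebra
    where the other factor is regular, by vanishing elsewhere. *)
Definition C1at (R : realType) (X : normedModType R) (f : X -> R) (z : X) :=
  (\forall w \near z, differentiable f w) /\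
  forall v, {for z, continuous (fun w => 'D_v f w)}.

Section C1at.
Context {R : realType} {X : normedModType R}.
Implicit Types (f g : X -> R) (z v : X).

Lemma C1at_diff f z : C1at f z -> differentiable f z.
Proof. by case=> /nbhs_singleton. Qed.

Lemma C1at_cts f z : C1at f z -> {for z, continuous f}.
Proof. by move=> /C1at_diff; exact: differentiable_continuous. Qed.

Lemma C1at_near f g z : (\forall w \near z, f w = g w) -> C1at f z -> C1at g z.
Proof.
move=> /nbhs_interior fg [df cf]; split.
  by near=> w; apply: (@near_differentiable _ _ f); near: w => //.
move=> v; apply: near_cts (cf v); near=> w.
by have [] := @near_derive _ _ _ f g w v _; first by near: w.
Unshelve. all: by end_near. Qed.

Lemma C1at_of f z (df : X -> X -> R) : (\forall w \near z, differentiable f w) ->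
  (forall v, \forall w \near z, 'D_v f w = df v w) ->
  (forall v, {for z, continuous (df v)}) -> C1at f z.
Proof.
move=> h1 h2 h3; split=> // v; apply: near_cts (h3 v).
by apply: filterS (h2 v) => w ->.
Qed.

Lemma C1at_cst (k : R) z : C1at (fun=> k) z.
Proof.
apply: (@C1at_of _ _ (fun _ _ => 0)) => [|v|v].
- by apply: nearW => w; exact: differentiable_cst.
- by apply: nearW => w; exact: derive_cst.
- exact: cst_continuous.
Qed.

Lemma C1atD f g z : C1at f z -> C1at g z -> C1at (fun w => f w + g w) z.
Proof.
move=> [df cf] [dg cg]; apply: (@C1at_of _ _ (fun v w => 'D_v f w + 'D_v g w)).
- by near=> w; apply: differentiableD; near: w.
- move=> v; near=> w; apply: deriveD; apply: diff_derivable; by near: w.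
- by move=> v; apply: cvgD; [exact: cf|exact: cg].
Unshelve. all: by end_near. Qed.

Lemma C1atN f z : C1at f z -> C1at (fun w => - f w) z.
Proof.
move=> [df cf]; apply: (@C1at_of _ _ (fun v w => - 'D_v f w)).
- by near=> w; apply: differentiableN; near: w.
- move=> v; near=> w; apply: deriveN; apply: diff_derivable; by near: w.
- by move=> v; apply: cvgN; exact: cf.
Unshelve. all: by end_near. Qed.

Lemma C1atB f g z : C1at f z -> C1at g z -> C1at (fun w => f w - g w) z.
Proof. by move=> cf cg; exact: C1atD cf (C1atN cg). Qed.

Lemma C1atM f g z : C1at f z -> C1at g z -> C1at (fun w => f w * g w) z.
Proof.
move=> Cf Cg; have ff := C1at_cts Cf; have gg := C1at_cts Cg.
case: Cf Cg => [df cf] [dg cg].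
apply: (@C1at_of _ _ (fun v w => f w * 'D_v g w + g w * 'D_v f w)).
- by near=> w; apply: differentiableM; near: w.
- move=> v; near=> w; apply: deriveM; apply: diff_derivable; by near: w.
- by move=> v; apply: cvgD; apply: cvgM => //; [exact: cg|exact: cf].
Unshelve. all: by end_near. Qed.

Lemma C1atV f z : f z != 0 -> C1at f z -> C1at (fun w => (f w)^-1) z.
Proof.
move=> f0 Cf; have ff := C1at_cts Cf; case: Cf => [df cf].
have fn : \forall w \near z, f w != 0 by exact: cvgr_neq0 ff f0.
apply: (@C1at_of _ _ (fun v w => - (f w)^-1 ^+ 2 * 'D_v f w)).
- near=> w; have fw : f w != 0 by near: w.
  by apply: differentiableV fw; near: w.
- move=> v; near=> w; have fw : f w != 0 by near: w.
  rewrite deriveV ?exprVn//.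
  by apply: diff_derivable; near: w.
- move=> v; apply: cvgM; last exact: cf.
  by apply: cvgN; rewrite expr2; apply: cvgM; exact: cvgV.
Unshelve. all: by end_near. Qed.

Lemma C1at_lin (L : {linear X -> R}) z : continuous L -> C1at L z.
Proof.
move=> cL; have dL w : differentiable L w by exact: linear_differentiable.
apply: (@C1at_of _ _ (fun v _ => L v)) => [|v|v].
- exact: nearW.
- by apply: nearW => w; rewrite deriveE// diff_lin.
- exact: cst_continuous.
Qed.

Lemma derive_comp1 (psi psi' : R -> R) f z v :
  (forall x : R, is_derive x (1 : R) psi (psi' x)) -> differentiable f z ->
  differentiable (fun w => psi (f w)) z /\
  'D_v (fun w => psi (f w)) z = psi' (f z) * 'D_v f z.
Proof.
move=> dpsi df.
have dp x : differentiable psi x by apply/derivable1_diffP; have [] := dpsi x.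
have dc : differentiable (psi \o f) z by exact: differentiable_comp.
have [dz _] := dpsi (f z).
split=> //; rewrite [LHS](deriveE _ dc) diff_comp ?dp//= deriveE// (deriv1E dz).
by rewrite derive1E mulrC; have [_ ->] := dpsi (f z).
Qed.

Lemma C1at_comp1 (psi psi' : R -> R) f z : continuous psi' ->
  (forall x : R, is_derive x (1 : R) psi (psi' x)) -> C1at f z ->
  C1at (fun w => psi (f w)) z.
Proof.
move=> cpsi dpsi Cf; have ff := C1at_cts Cf; case: Cf => [df cf].
apply: (@C1at_of _ _ (fun v w => psi' (f w) * 'D_v f w)).
- near=> w; apply: (@derive_comp1 psi psi' f w 0 dpsi _).1; by near: w.
- move=> v; near=> w; apply: (@derive_comp1 psi psi' f w v dpsi _).2; by near: w.
- move=> v; apply: cvgM; last exact: cf.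
  by apply: continuous_comp; [exact: ff|exact: cpsi].
Unshelve. all: by end_near. Qed.

End C1at.

(** * Composition with affine maps and curves *)

Section Line.
Context {R : realType} {X Y : normedModType R}.

Lemma derive_affine (f : X -> R) (L : {linear Y -> X}) (x : X) (y v : Y) :
  continuous L -> differentiable f (x + L y) ->
  differentiable (fun y => f (x + L y)) y /\
  'D_v (fun y => f (x + L y)) y = 'D_(L v) f (x + L y).
Proof.
move=> cL df.
have dL : differentiable L y by exact: linear_differentiable.
have dg : differentiable (cst x + L) y by exact: differentiableD.
have dc : differentiable (f \o (cst x + L)) y by exact: differentiable_comp.
split=> //.
rewrite [LHS](deriveE _ dc) diff_comp//= diffD//= diff_cst diff_lin// deriveE//.
by rewrite fctE/= add0r.
Qed.

Lemma C1at_affine (f : X -> R) (L : {linear Y -> X}) (x : X) (y : Y) :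
  continuous L -> C1at f (x + L y) -> C1at (fun y => f (x + L y)) y.
Proof.
move=> cL [df cf].
have cg : (x + L y') @[y' --> y] --> x + L y by apply: cvgD; [exact: cvg_cst|exact: cL].
have df' : \forall y' \near y, differentiable f (x + L y') by exact: cg df.
apply: (@C1at_of R Y (fun y => f (x + L y)) y (fun v y => 'D_(L v) f (x + L y))).
- by near=> w; apply: (derive_affine 0 cL _).1; near: w; exact: df'.
- by move=> v; near=> w; apply: (derive_affine v cL _).2; near: w; exact: df'.
- by move=> v; exact: (cvg_comp _ _ cg (cf (L v))).
Unshelve. all: by end_near. Qed.

Lemma chain_curve (f : X -> R) (g : R -> X) (s : R) (w : X) :
  differentiable f (g s) -> is_derive s (1 : R) g w ->
  is_derive s (1 : R) (fun t => f (g t)) ('D_w f (g s)).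
Proof.
move=> df [dg gw].
have dg' : differentiable g s by exact/derivable1_diffP.
have dc : differentiable (f \o g) s by exact: differentiable_comp.
split; first exact: diff_derivable.
by rewrite [LHS](deriveE _ dc) diff_comp//= [RHS]deriveE// -gw deriveE.
Qed.

End Line.

Lemma cvg_sumr (R : realType) (T I : Type) (F : set_system T) (FF : Filter F)
    (r : seq I) (f : I -> T -> R) (l : I -> R) :
  (forall i, f i x @[x --> F] --> l i) ->
  \sum_(i <- r) f i x @[x --> F] --> \sum_(i <- r) l i.
Proof.
by move=> fl; apply: cvg_big => [|i _]; [exact: add_continuous|exact: fl].
Qed.

(** * Continuous partial derivatives imply differentiability *)

Section Partials.
Context {R : realType} {X : normedModType R}.
Variables (I : finType) (e : I -> X).

(** The increment is telescoped, one direction of [r] at a time: [y] holds the displacement already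
    made, and the mean value theorem treats the next one. The bound by [d] on the total length keeps
    all intermediate points in the ball where the derivatives are controlled. *)
Lemma partials_expand (r : seq I) (f : X -> R) (x : X) (eps d : R) : 0 <= eps ->
  (forall i w, `|w - x| < d ->
     derivable f w (e i) /\ `|'D_(e i) f w - 'D_(e i) f x| <= eps) ->
  forall y (a : I -> R), `|y| + \sum_(i <- r) `|a i| * `|e i| < d ->
  `|f (x + y + \sum_(i <- r) a i *: e i) - f (x + y)
    - \sum_(i <- r) a i * 'D_(e i) f x| <= eps * \sum_(i <- r) `|a i|.
Proof.
move=> eps0 df; elim: r => [|i r IH] y a; first by rewrite !big_nil !addr0 subrr subr0 normr0 mulr0.
rewrite !big_cons => yd.
have S0 : 0 <= \sum_(j <- r) `|a j| * `|e j| by apply: sumr_ge0 => j _; rewrite mulr_ge0.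
have yi : `|y + a i *: e i| + \sum_(j <- r) `|a j| * `|e j| < d.
  by apply: le_lt_trans yd; rewrite addrA lerD2r (le_trans (ler_normD _ _))// normrZ.
have := IH (y + a i *: e i) a yi; set S := \sum_(j <- r) a j *: e j.
set T := \sum_(j <- r) a j * _; rewrite (addrA x) -(addrA (x + y)) => H.
have in_ball s : `|s| <= `|a i| -> `|(x + y + s *: e i) - x| < d.
  move=> sa; rewrite -(addrA x) addrAC subrr add0r; apply: le_lt_trans yd.
  rewrite (le_trans (ler_normD _ _))// lerD2l normrZ.
  by apply: (@le_trans _ _ (`|a i| * `|e i|)); [rewrite ler_wpM2r|rewrite lerDl].
have [s sa E] := @line_MVT R X f (x + y) (e i) (a i) (fun s sa => (df i _ (in_ball s sa)).1).
rewrite mulrDr.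
set A := f _ in H *; set B := f _ in H E; set C := f _ in E *.
have -> : A - C - (a i * 'D_(e i) f x + T) =
    a i * ('D_(e i) f (x + y + s *: e i) - 'D_(e i) f x) + (A - B - T).
  by rewrite mulrBr -E; ring.
rewrite (le_trans (ler_normD _ _))// lerD// normrM mulrC ler_wpM2r//.
by have [] := df i _ (in_ball s sa).
Qed.

Variable c : I -> {linear X -> R}.
Hypothesis cc : forall i, continuous (c i).
Hypothesis cE : forall h, h = \sum_i c i h *: e i.

Lemma derive_coord (f : X -> R) (w v : X) : differentiable f w ->
  'D_v f w = \sum_i c i v * 'D_(e i) f w.
Proof.
move=> df; rewrite deriveE// [in LHS](cE v) linear_sum; apply: eq_bigr => i _.
by rewrite linearZ/= deriveE.
Qed.

Lemma partials_differentiable (f : X -> R) (z : X) :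
  (forall i, \forall w \near z, derivable f w (e i)) ->
  (forall i, {for z, continuous (fun w => 'D_(e i) f w)}) ->
  differentiable f z.
Proof.
move=> df cf.
have [k k0 ck] : exists2 k, 0 < k & forall i h, `|c i h| <= k * `|h|.
  have /choice[k kP] i : exists k, 0 < k /\ forall h, `|c i h| <= k * `|h|.
    by have [k k0 kP] := linear_lipschitz (@cc i); exists k.
  exists (1 + \sum_i k i).
    by rewrite ltr_pwDl// sumr_ge0// => i _; rewrite ltW// (kP i).1.
  move=> i h; apply: le_trans ((kP i).2 h) _; rewrite ler_wpM2r//.
  rewrite (bigD1 i)//= addrCA lerDl addr_ge0// sumr_ge0// => j _.
  by rewrite ltW// (kP j).1.
pose L h := \sum_i c i h * 'D_(e i) f z.
have Llin : linear L.
  move=> a u v; rewrite /L scaler_sumr -big_split/=; apply: eq_bigr => i _.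
  by rewrite linearP/= mulrDl scalerAl.
pose LM := GRing.isLinear.Build _ _ _ _ _ Llin.
pose LL : {linear X -> R} := HB.pack L LM.
have cL : continuous LL.
  move=> x; apply: (@cvg_sumr _ _ _ _ _ _ (fun i h => c i h * 'D_(e i) f z)) => i.
  by apply: cvgM; [exact: cc|exact: cvg_cst].
apply: (differentiable_of cL) => eps eps0.
(* [S] times the norm of [h] bounds the sum of the coordinates of [h], hence the choice of [ep];
   [S'] times that norm bounds the length of the coordinate path, which must stay below [d]. *)
pose S := \sum_(i : I) k; pose S' := \sum_i k * `|e i|.
have S0 : 0 <= S by rewrite sumr_ge0// => i _; exact: ltW.
have S'0 : 0 <= S' by rewrite sumr_ge0// => i _; rewrite mulr_ge0// ltW.
pose ep := eps / (S + 1).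
have ep0 : 0 < ep by rewrite divr_gt0// ltr_wpDl.
have [d d0 dP] : exists2 d, 0 < d & forall i w, `|w - z| < d ->
    derivable f w (e i) /\ `|'D_(e i) f w - 'D_(e i) f z| <= ep.
  have H : \forall w \near z, forall i,
      derivable f w (e i) /\ `|'D_(e i) f w - 'D_(e i) f z| <= ep.
    apply: filter_forall => i; near=> w; split; first by near: w; exact: df.
    by rewrite distrC; near: w; move/cvgrPdist_le: (cf i); exact.
  have /nbhs_ballP[d d0 dP] := H; exists d => // i w wd.
  by apply: dP; rewrite -ball_normE/= distrC.
near=> h.
have hS : S' * `|h| < d.
  have : `|h| < d / (S' + 1).
    by near: h; apply: nbhs0_lt; rewrite divr_gt0// ltr_wpDl.
  rewrite ltr_pdivlMr ?ltr_wpDl// => H; apply: le_lt_trans H.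
  by rewrite mulrC ler_wpM2l// lerDl.
have := @partials_expand (index_enum I) f z ep d (ltW ep0) dP 0 (c ^~ h).
rewrite normr0 add0r addr0 -cE (addrC z) => H.
apply: le_trans (H _) _.
  apply: le_lt_trans hS; rewrite /S' mulr_suml; apply: ler_sum => i _.
  by rewrite mulrAC ler_wpM2r.
apply: (@le_trans _ _ (ep * (S * `|h|))).
  by rewrite ler_pM2l// /S mulr_suml; apply: ler_sum => i _; exact: ck.
rewrite mulrA ler_wpM2r// /ep mulrAC ler_pdivrMr ?ltr_wpDl//.
by rewrite ler_pM2l// lerDl.
Unshelve. all: by end_near. Qed.

Lemma partials_C1at (f : X -> R) (W : set X) : open W ->
  (forall i w, W w -> derivable f w (e i) /\
     {for w, continuous (fun w => 'D_(e i) f w)}) ->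
  forall z, W z -> C1at f z.
Proof.
move=> oW df z Wz.
have nW w : W w -> \forall w' \near w, W w' by move=> Ww; exact: open_nbhs_nbhs.
have D w : W w -> differentiable f w.
  move=> Ww; apply: partials_differentiable => i; last by have [] := df i w Ww.
  by apply: filterS (nW w Ww) => w' /(df i)[].
apply: (@C1at_of _ _ _ _ (fun v w => \sum_i c i v * 'D_(e i) f w)).
- by apply: filterS (nW z Wz) => w /D.
- by move=> v; apply: filterS (nW z Wz) => w /D; exact: derive_coord.
- move=> v; apply: (@cvg_sumr _ _ _ _ _ _ (fun i w => c i v * 'D_(e i) f w)) => i.
  by apply: cvgM; [exact: cvg_cst|have [] := df i z Wz].
Qed.

End Partials.

(** * Pompeiu's formula in polar coordinates *)

Section Polar.
Context {R : realType} {X : normedModType R}.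
Variables (a b : X).
Implicit Types (z v : X) (A B p q : X -> R).
Local Notation twopi := (pi *+ 2 : R).

Definition circ z (r t : R) : X := z + ((r * cos t) *: a + (r * sin t) *: b).

(** When [a], [b] are the real and imaginary directions of a complex variable, this is the real part
    of the integral of (A + i B) / zeta over the disc of radius [rho], zeta = r e^{it} being the
    displacement from [z]: the Jacobian r cancels, and Re (e^{-it} (A + i B)) = cos t A + sin t B.
    The imaginary part is the same integral for [B] and [- A]. *)
Definition polar_int (rho : R) A B z : R :=
  intg 0 rho (fun r => intg 0 twopi
    (fun t => cos t * A (circ z r t) + sin t * B (circ z r t))).

Let twopi0 : 0 <= twopi. Proof. by rewrite mulrn_wge0// pi_ge0. Qed.

Lemma ctsZ (T : topologicalType) (k : T -> R) (u : X) :
  continuous k -> continuous (fun x => k x *: u).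
Proof. by move=> ck x; apply: cvgZr_tmp; exact: ck. Qed.

Lemma ctsDv (T : topologicalType) (f g : T -> X) :
  continuous f -> continuous g -> continuous (fun x => f x + g x).
Proof. by move=> cf cg x; apply: cvgD; [exact: cf|exact: cg]. Qed.

Lemma cts_cos (T : topologicalType) (k : T -> R) :
  continuous k -> continuous (fun x => cos (k x)).
Proof. by move=> ck; apply: cts_comp ck _; exact: continuous_cos. Qed.

Lemma cts_sin (T : topologicalType) (k : T -> R) :
  continuous k -> continuous (fun x => sin (k x)).
Proof. by move=> ck; apply: cts_comp ck _; exact: continuous_sin. Qed.

Lemma cts_circ (T : topologicalType) (f : T -> X) (g h : T -> R) :
  continuous f -> continuous g -> continuous h ->
  continuous (fun x => circ (f x) (g x) (h x)).
Proof.
move=> cf cg ch; apply: ctsDv => //; apply: ctsDv; apply: ctsZ; apply: ctsM => //.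
  exact: cts_cos.
exact: cts_sin.
Qed.

Lemma cts_integrand (T : topologicalType) A B (f : T -> X) (g h : T -> R) :
  continuous A -> continuous B ->
  continuous f -> continuous g -> continuous h ->
  continuous (fun x => cos (h x) * A (circ (f x) (g x) (h x)) +
                       sin (h x) * B (circ (f x) (g x) (h x))).
Proof.
move=> cA cB cf cg ch; have cc := cts_circ cf cg ch.
apply: ctsD; apply: ctsM; [exact: cts_cos| |exact: cts_sin|].
- exact: cts_comp cc cA.
- exact: cts_comp cc cB.
Qed.

Lemma cts_inner (T : topologicalType) A B (f : T -> X) (g : T -> R) :
  continuous A -> continuous B -> continuous f -> continuous g ->
  continuous (fun x => intg 0 twopi
    (fun t => cos t * A (circ (f x) (g x) t) + sin t * B (circ (f x) (g x) t))).
Proof.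
move=> cA cB cf cg.
apply: (@intg_continuous _ _ _ _ (fun x : T * R =>
  cos x.2 * A (circ (f x.1) (g x.1) x.2) + sin x.2 * B (circ (f x.1) (g x.1) x.2))) => //.
apply: cts_integrand => //; [| |exact: cts_snd].
- by apply: cts_comp cf; exact: cts_fst.
- by apply: cts_comp cg; exact: cts_fst.
Qed.

Lemma cts_polar rho A B : 0 <= rho -> continuous A -> continuous B ->
  continuous (polar_int rho A B).
Proof.
move=> rho0 cA cB.
apply: (@intg_continuous _ _ _ _ (fun x : X * R => intg 0 twopi
    (fun t => cos t * A (circ x.1 x.2 t) + sin t * B (circ x.1 x.2 t)))) => //.
by apply: cts_inner => //; [exact: cts_fst|exact: cts_snd].
Qed.

Lemma is_derive_shift p (s x v : X) : derivable p (x + s) v ->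
  is_derive x v (fun x => p (x + s)) ('D_v p (x + s)).
Proof.
move=> dp.
have E : (fun h : R => h^-1 *: (((fun x => p (x + s)) \o shift x) (h *: v) - p (x + s))) =
         (fun h : R => h^-1 *: ((p \o shift (x + s)) (h *: v) - p (x + s))).
  by apply/funext => h /=; rewrite addrA.
by split; rewrite /derivable /derive E.
Qed.

Lemma polar_derive rho A B v z : 0 <= rho -> continuous A -> continuous B ->
  continuous (fun z => 'D_v A z) -> continuous (fun z => 'D_v B z) ->
  (forall z, derivable A z v) -> (forall z, derivable B z v) ->
  is_derive z v (polar_int rho A B)
    (polar_int rho (fun z => 'D_v A z) (fun z => 'D_v B z) z).
Proof.
move=> rho0 cA cB cA' cB' dA dB.
have cI (F G : X -> R) : continuous F -> continuous G ->
    continuous (fun x : X * R => intg 0 twopi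
      (fun t => cos t * F (circ x.1 x.2 t) + sin t * G (circ x.1 x.2 t))).
  by move=> cF cG; apply: cts_inner => //; [exact: cts_fst|exact: cts_snd].
apply: (intg_is_derive z rho0 (cI A B cA cB) (cI _ _ cA' cB')) => x r /=.
have cK (F G : X -> R) : continuous F -> continuous G ->
    continuous (fun x : X * R =>
      cos x.2 * F (circ x.1 r x.2) + sin x.2 * G (circ x.1 r x.2)).
  move=> cF cG; apply: cts_integrand => //; [exact: cts_fst|exact: cts_cst|].
  exact: cts_snd.
apply: (intg_is_derive x twopi0 (cK A B cA cB) (cK _ _ cA' cB')) => y t /=.
by apply: is_deriveD; apply: is_deriveZ; exact: is_derive_shift.
Qed.

Lemma polar_lin rho A B A' B' (k k' : R) z : 0 <= rho ->
  continuous A -> continuous B -> continuous A' -> continuous B' ->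
  polar_int rho (fun w => k * A w + k' * A' w) (fun w => k * B w + k' * B' w) z =
  k * polar_int rho A B z + k' * polar_int rho A' B' z.
Proof.
move=> rho0 cA cB cA' cB'.
have cz : continuous (fun _ : R => z) by exact: cts_cst.
have ci (F G : X -> R) : continuous F -> continuous G -> continuous (fun r => intg 0 twopi
    (fun t => cos t * F (circ z r t) + sin t * G (circ z r t))).
  by move=> cF cG; apply: cts_inner => //; exact: cts_id.
have ck (F G : X -> R) (r : R) : continuous F -> continuous G -> continuous
    (fun t => cos t * F (circ z r t) + sin t * G (circ z r t)).
  by move=> cF cG; apply: cts_integrand => //; [exact: cts_cst|exact: cts_id].
have cc (f : R -> R) (m : R) : continuous f -> continuous (fun x => m * f x).
  by move=> cf; apply: ctsM => //; exact: cts_cst.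
rewrite /polar_int -(intgZ _ _ k (ci A B cA cB)) -(intgZ _ _ k' (ci A' B' cA' cB')).
rewrite -intgD; [|by apply: cc; exact: ci..].
apply: eq_intg => r _.
rewrite -(intgZ _ _ k (ck A B r cA cB)) -(intgZ _ _ k' (ck A' B' r cA' cB')).
rewrite -intgD; [|by apply: cc; exact: ck..].
by apply: eq_intg => t _; ring.
Qed.

Lemma polar_le rho A B M z : 0 <= rho -> continuous A -> continuous B ->
  (forall w, `|A w| <= M) -> (forall w, `|B w| <= M) ->
  `|polar_int rho A B z| <= (M + M) * twopi * rho.
Proof.
move=> rho0 cA cB AM BM.
have M0 : 0 <= M by apply: le_trans (AM z).
have cz : continuous (fun _ : R => z) by exact: cts_cst.
rewrite -[X in _ * X]subr0; apply: intg_le_norm => //.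
  by apply: cts_inner => //; exact: cts_id.
move=> r _; rewrite -[X in _ * X]subr0; apply: intg_le_norm => //.
  by apply: cts_integrand => //; [exact: cts_cst|exact: cts_id].
move=> t _; apply: le_trans (ler_normD _ _) _; apply: lerD; rewrite normrM.
- rewrite -[M]mul1r ler_pM// ler_norml; apply/andP; split; [exact: cos_geN1|exact: cos_le1].
- rewrite -[M]mul1r ler_pM// ler_norml; apply/andP; split; [exact: sin_geN1|exact: sin_le1].
Qed.

Lemma is_derive_Zl (k : R -> R) (u : X) (s dk : R) :
  is_derive s (1 : R) k dk -> is_derive s (1 : R) (fun x => k x *: u) (dk *: u).
Proof.
move=> [dks kE]; have dk' : differentiable k s by exact/derivable1_diffP.
have dz : differentiable (fun x => k x *: u) s by exact: differentiableZl.
split; first exact/derivable1_diffP.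
by rewrite deriveE// diffZl// -kE deriveE.
Qed.

Lemma circ_derive_r z r t :
  is_derive r (1 : R) (fun r => circ z r t) (cos t *: a + sin t *: b).
Proof.
have H (k : R) : is_derive r (1 : R) (fun r : R => r * k) k.
  have := @is_deriveM R _ (fun r => r) (fun=> k) r 1 1 0 (is_derive_id _ _) (is_derive_cst _ _ _).
  by move=> h; apply: (is_derive_eq h); rewrite scaler0 add0r [LHS]mulr1.
have := is_deriveD (is_derive_cst z r (1 : R))
  (is_deriveD (is_derive_Zl a (H (cos t))) (is_derive_Zl b (H (sin t)))).
by move=> h; apply: (is_derive_eq h); rewrite add0r.
Qed.

Lemma circ_derive_t z r t :
  is_derive t (1 : R) (circ z r) ((- (r * sin t)) *: a + (r * cos t) *: b).
Proof.
have H (k : R -> R) dk : is_derive t (1 : R) k dk ->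
    is_derive t (1 : R) (fun t => r * k t) (r * dk).
  exact: is_deriveZ.
have := is_deriveD (is_derive_cst z t (1 : R))
  (is_deriveD (is_derive_Zl a (H _ _ (is_derive_cos t)))
              (is_derive_Zl b (H _ _ (is_derive_sin t)))).
by move=> h; apply: (is_derive_eq h); rewrite add0r mulrN.
Qed.

Lemma circ0 z t : circ z 0 t = z.
Proof. by rewrite /circ !mul0r !scale0r !addr0. Qed.

Lemma circ2pi z r : circ z r twopi = circ z r 0.
Proof. by rewrite /circ cos2pi sin2pi cos0 sin0. Qed.

Section C1.
Variable p : X -> R.
Hypothesis dp : forall z, differentiable p z.
Hypothesis cp : forall v, continuous (fun z => 'D_v p z).

Let cp0 : continuous p.
Proof. by move=> z; exact: differentiable_continuous. Qed.

(** The integrand is the radial derivative of [p] along [circ], so the double integral is the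
    increment of the circular integral [J] from radius 0, where the circle is the point [z], to
    radius [rho]. *)
Lemma radial_int rho z : 0 <= rho ->
  polar_int rho (fun z => 'D_a p z) (fun z => 'D_b p z) z =
  intg 0 twopi (fun t => p (circ z rho t)) - p z * twopi.
Proof.
move=> rho0.
have cz : continuous (fun _ : R => z) by exact: cts_cst.
pose J (r : R) := intg 0 twopi (fun t => p (circ z r t)).
transitivity (J rho - J 0); last first.
  congr (_ - _); rewrite /J; under eq_fun do rewrite circ0.
  by rewrite intg_cst// subr0.
have ca : continuous (fun w => 'D_a p w) by exact: cp.
have cb : continuous (fun w => 'D_b p w) by exact: cp.
apply: intg_FTC => //.
  by refine (@cts_inner _ _ _ (fun=> z) (fun r => r) ca cb cz _); exact: cts_id.
move=> r.
apply: (@intg_is_derive _ R 0 twopi (fun x => p (circ z x.1 x.2))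
  (fun x => cos x.2 * 'D_a p (circ z x.1 x.2) + sin x.2 * 'D_b p (circ z x.1 x.2))
  r 1) => //.
- apply: cts_comp (cp0); apply: cts_circ; [exact: cts_cst|exact: cts_fst|exact: cts_snd].
- refine (@cts_integrand _ _ _ (fun=> z) (fun x => x.1) (fun x => x.2) ca cb _ _ _);
    [exact: cts_cst|exact: cts_fst|exact: cts_snd].
move=> s t /=.
have := @chain_curve _ _ p (fun r => circ z r t) s _ (dp _) (circ_derive_r z s t).
by move=> h; apply: (is_derive_eq h); rewrite derive_lin.
Qed.

(** For nonzero [r] the integrand is [r^-1] times the derivative in [t] of the periodic function
    [p (circ z r t)]. For [r = 0] the derivatives of [p] are constant, and cos and sin integrate to
    0 over a period. *)
Lemma angular_int z r :
  intg 0 twopi (fun t => cos t * 'D_b p (circ z r t) - sin t * 'D_a p (circ z r t)) = 0.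
Proof.
have ci : continuous (fun t => circ z r t).
  by apply: cts_circ; [exact: cts_cst|exact: cts_cst|exact: cts_id].
have cd v : continuous (fun t => 'D_v p (circ z r t)).
  by have := @cts_comp _ _ _ (circ z r) (fun w => 'D_v p w) ci (@cp v).
have cK : continuous (fun t => cos t * 'D_b p (circ z r t) - sin t * 'D_a p (circ z r t)).
  apply: ctsB; apply: ctsM.
  - exact: continuous_cos.
  - exact: cd.
  - exact: continuous_sin.
  - exact: cd.
have [->|r0] := eqVneq r 0.
  under eq_fun do rewrite circ0.
  pose P t := sin t * 'D_b p z + cos t * 'D_a p z.
  transitivity (P twopi - P 0); last by rewrite /P cos2pi sin2pi cos0 sin0 subrr.
  apply: intg_FTC => //.
  - apply: ctsB; apply: ctsM; try exact: cts_cst.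
    + exact: continuous_cos.
    + exact: continuous_sin.
  move=> t.
  have H (k : R -> R) dk m : is_derive t (1 : R) k dk ->
      is_derive t (1 : R) (fun t => k t * m) (dk * m).
    move=> hk; have : is_derive t (1 : R) (fun t => m * k t) (m * dk) by exact: is_deriveZ.
    by rewrite mulrC; under eq_fun do rewrite mulrC.
  have := is_deriveD (H _ _ ('D_b p z) (is_derive_sin t)) (H _ _ ('D_a p z) (is_derive_cos t)).
  by move=> h; apply: (is_derive_eq h); rewrite mulNr.
pose P t := r^-1 * p (circ z r t).
transitivity (P twopi - P 0); last by rewrite /P circ2pi subrr.
apply: intg_FTC => // t.
have := @chain_curve _ _ p (circ z r) t _ (dp _) (circ_derive_t z r t).
rewrite derive_lin// => H.
have : is_derive t (1 : R) (fun t => r^-1 * p (circ z r t))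
  (r^-1 * (- (r * sin t) * 'D_a p (circ z r t) + r * cos t * 'D_b p (circ z r t))).
  exact: is_deriveZ.
by move=> h; apply: (is_derive_eq h); field.
Qed.

End C1.

(* In polar coordinates [e^{-it} * 2 dbar = d/dr + (i/r) d/dt]: the radial part
   integrates to the value at the centre, the angular part to zero. *)
Lemma pompeiu p q rho z : 0 <= rho ->
  (forall w, C1at p w) -> (forall w, C1at q w) ->
  (forall t, p (circ z rho t) = 0) ->
  polar_int rho (fun w => 'D_a p w - 'D_b q w) (fun w => 'D_a q w + 'D_b p w) z =
  - (p z * twopi).
Proof.
move=> rho0 Cp Cq p0.
have dp w : differentiable p w by exact: C1at_diff.
have dq w : differentiable q w by exact: C1at_diff.
have cp v : continuous (fun w => 'D_v p w) by move=> w; exact: (Cp w).2.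
have cq v : continuous (fun w => 'D_v q w) by move=> w; exact: (Cq w).2.
have cz : continuous (fun _ : R => z) by exact: cts_cst.
transitivity (polar_int rho (fun w => 'D_a p w) (fun w => 'D_b p w) z).
  apply: eq_intg => r _.
  have ci : continuous (circ z r).
    by apply: cts_circ; [exact: cts_cst|exact: cts_cst|exact: cts_id].
  have cdp v : continuous (fun t => 'D_v p (circ z r t)).
    by have := @cts_comp _ _ _ (circ z r) (fun w => 'D_v p w) ci (cp v).
  have cdq v : continuous (fun t => 'D_v q (circ z r t)).
    by have := @cts_comp _ _ _ (circ z r) (fun w => 'D_v q w) ci (cq v).
  rewrite -[RHS]subr0 -[X in _ = _ - X](angular_int dq cq z r) -intgB.
  - by apply: eq_intg => t _; ring.
  - by apply: ctsD; apply: ctsM => //; [exact: continuous_cos|exact: continuous_sin].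
  - by apply: ctsB; apply: ctsM => //; [exact: continuous_cos|exact: continuous_sin].
rewrite radial_int//; under eq_intg do rewrite p0.
by rewrite intg_cst// mul0r sub0r.
Qed.

Lemma polar_trunc A B rho rho' z : 0 <= rho <= rho' ->
  continuous A -> continuous B ->
  (forall r t, rho <= r -> A (circ z r t) = 0) ->
  (forall r t, rho <= r -> B (circ z r t) = 0) ->
  polar_int rho' A B z = polar_int rho A B z.
Proof.
move=> rr cA cB A0 B0; apply: intg_trunc => //.
  by apply: cts_inner => //; [exact: cts_cst|exact: cts_id].
move=> r hr; rewrite (@eq_intg _ _ _ _ (fun=> 0)) ?intg_cst ?mul0r//.
by move=> t _; rewrite A0// B0// !mulr0 addr0.
Qed.

End Polar.

(** * Cutoff functions *)

Section Bump.
Context {R : realType}.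

Definition ppow (n : nat) (x : R) : R := Num.max x 0 ^+ n.

Lemma ppow_gt0 n (x : R) : 0 <= x -> ppow n x = x ^+ n.
Proof. by move=> x0; rewrite /ppow max_l. Qed.

Lemma ppow_le0 n (x : R) : x <= 0 -> ppow n.+1 x = 0.
Proof. by move=> x0; rewrite /ppow max_r// exprS mul0r. Qed.

Lemma is_derive_ppow n (x : R) :
  is_derive x (1 : R) (ppow n.+2) (n.+2%:R * ppow n.+1 x).
Proof.
have [x0|x0|->] := ltgtP x 0.
- have E : \forall w \near x, (fun=> 0 : R) w = ppow n.+2 w.
    near=> w; rewrite ppow_le0// ltW//; near: w; exact: lt_nbhsl.
  have [D d] := near_derive (1 : R) E.
  split; first exact/d/derivable_cst.
  by rewrite -D derive_cst ppow_le0 ?mulr0// ltW.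
- have E : \forall w \near x, (fun w : R => w ^+ n.+2) w = ppow n.+2 w.
    near=> w; rewrite ppow_gt0// ltW//; near: w; exact: lt_nbhsr.
  have [D d] := near_derive (1 : R) E.
  split; first by apply: d; exact: exprn_derivable.
  by rewrite -D exp_derive/= ppow_gt0 ?(ltW x0)// [LHS]mulr1.
(* At 0 the exponent, at least 2, bounds the power by the square of [h] for small [h], so the
   differential is the zero map. *)
- have L0 : linear (fun _ : R => 0 : R) by move=> a u v; rewrite scaler0 addr0.
  pose LM := GRing.isLinear.Build _ _ _ _ _ L0.
  pose LL : {linear R -> R} := HB.pack (fun _ : R => 0 : R) LM.
  have cL : continuous LL by exact: cts_cst.
  have H e : 0 < e -> \forall h \near (0 : R),
      `|ppow n.+2 (h + 0) - ppow n.+2 0 - LL h| <= e * `|h|.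
    move=> e0; near=> h.
    rewrite addr0 (ppow_le0 _ (lexx 0)) !subr0 /ppow exprS normrM mulrC.
    have mh : `|Num.max h 0| <= `|h|.
      by rewrite /Num.max; case: ifP => // _; rewrite normr0.
    apply: ler_pM => //; rewrite normrX.
    have h1 : `|h| <= 1 by near: h; exact: (@nbhs0_le _ R^o).
    have he : `|h| <= e by near: h; exact: (@nbhs0_le _ R^o).
    rewrite exprS; apply: (le_trans _ he); apply: (le_trans _ mh).
    by rewrite ler_piMr// exprn_ile1// (le_trans mh).
  have df := differentiable_of cL H.
  split; first exact: diff_derivable.
  rewrite deriveE// (@diff_unique _ _ _ _ LL)//.
    by rewrite ppow_le0 ?mulr0.
  apply/eqaddoP => e /H; apply: filterS => h.
  by rewrite !fctE/= opprD addrA.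
Unshelve. all: by end_near. Qed.

Lemma cts_ppow1 : continuous (ppow 1).
Proof.
have -> : ppow 1 = fun x => (x + `|x|) * 2^-1.
  apply/funext => x; rewrite /ppow expr1; have [x0|x0] := leP 0 x.
    by rewrite ger0_norm//; field.
  by rewrite ltr0_norm// subrr mul0r.
apply: ctsM; last exact: cts_cst.
by apply: ctsD; [exact: cts_id|exact: norm_continuous].
Qed.

(* The third difference of [x |-> max(x, 0)^3 / 6] is a C^2 step, 0 before 0 and
   1 after 3; [psi] is a difference of two translates. *)
Lemma bump1 : exists psi psi' psi'' : R -> R,
  [/\ forall x : R, is_derive x (1 : R) psi (psi' x),
      forall x : R, is_derive x (1 : R) psi' (psi'' x),
      continuous psi'',
      forall x, `|x| <= 2 -> psi x = 1 &
      forall x, 5 <= `|x| -> psi x = 0].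
Proof.
pose S (f : R -> R) (x : R) := (f x - 3 * f (x - 1) + 3 * f (x - 2) - f (x - 3)) / 6.
(* The step rising on [-5, -2] minus the step rising on [2, 5]; hence the radii 2 and 5. *)
pose B f x := S f (x + 5) - S f (x - 2).
have shiftd (f f' : R -> R) k : (forall x : R, is_derive x (1 : R) f (f' x)) ->
    forall x : R, is_derive x (1 : R) (fun x => f (x + k)) (f' (x + k)).
  move=> df x; have [d1 d2] := df (x + k); rewrite -d2; exact: is_derive_shift.
have Zd (f f' : R -> R) k : (forall x : R, is_derive x (1 : R) f (f' x)) ->
    forall x : R, is_derive x (1 : R) (fun x => k * f x) (k * f' x).
  by move=> df x; exact: is_deriveZ.
have Sd f f' : (forall x : R, is_derive x (1 : R) f (f' x)) ->
    forall x : R, is_derive x (1 : R) (S f) (S f' x).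
  move=> df x.
  have -> : S f = fun x => 6^-1 * (f x - 3 * f (x - 1) + 3 * f (x - 2) - f (x - 3)).
    by apply/funext => y; rewrite mulrC.
  rewrite /S mulrC; apply: (Zd _ (fun x => f' x - 3 * f' (x - 1) + 3 * f' (x - 2) - f' (x - 3))).
have Bd f f' : (forall x : R, is_derive x (1 : R) f (f' x)) ->
    forall x : R, is_derive x (1 : R) (B f) (B f' x).
  move=> df x; have d k := shiftd (S f) (S f') k (Sd f f' df) x.
  exact: (is_deriveB (d _) (d _)).
exists (B (ppow 3)), (B (fun x => 3 * ppow 2 x)), (B (fun x => 3 * (2 * ppow 1 x))); split.
- by apply: Bd => x; exact: is_derive_ppow.
- by apply: Bd => x; apply: (Zd (ppow 2) (fun x => 2 * ppow 1 x)) => y; exact: is_derive_ppow.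
- have shiftc (f : R -> R) k : continuous f -> continuous (fun x => f (x + k)).
    by move=> cf; apply: (cts_comp _ cf); apply: ctsD; [exact: cts_id|exact: cts_cst].
  have Sc f : continuous f -> continuous (S f).
    move=> cf; apply: ctsM; last exact: cts_cst.
    apply: ctsB; last exact: shiftc.
    apply: ctsD; last by apply: ctsM; [exact: cts_cst|exact: shiftc].
    by apply: ctsB => //; apply: ctsM; [exact: cts_cst|exact: shiftc].
  have cS : continuous (S (fun x => 3 * (2 * ppow 1 x))).
    apply: Sc; apply: ctsM; first exact: cts_cst.
    by apply: ctsM; [exact: cts_cst|exact: cts_ppow1].
  by apply: ctsB; exact: shiftc.
- have S0 x : x <= 0 -> S (ppow 3) x = 0.
    by move=> x0; rewrite /S !ppow_le0; lra.
  have S1 x : 3 <= x -> S (ppow 3) x = 1.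
    by move=> x3; rewrite /S !ppow_gt0; [field|lra..].
  by move=> x; rewrite ler_norml => /andP[x1 x2]; rewrite /B S1 ?S0 ?subr0//; lra.
- have S0 x : x <= 0 -> S (ppow 3) x = 0.
    by move=> x0; rewrite /S !ppow_le0; lra.
  have S1 x : 3 <= x -> S (ppow 3) x = 1.
    by move=> x3; rewrite /S !ppow_gt0; [field|lra..].
  move=> x; rewrite ler_normr => /orP[] x1; rewrite /B.
    by rewrite !S1 ?subrr//; lra.
  by rewrite !S0 ?subrr//; lra.
Qed.

End Bump.

(** Symmetry of the second derivatives is a clause of the definition: it is checked on one-variable
    functions of an affine form and propagated through products, instead of being deduced from
    continuity. *)
Definition C2 (R : realType) (X : normedModType R) (f : X -> R) :=
  [/\ forall z, differentiable f z,
      forall v z, C1at (fun w => 'D_v f w) z &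
      forall v w z, 'D_w (fun y => 'D_v f y) z = 'D_v (fun y => 'D_w f y) z].

Section C2.
Context {R : realType} {X : normedModType R}.
Implicit Types (f g : X -> R).

Lemma C2_C1at f z : C2 f -> C1at f z.
Proof.
move=> [df cf _]; split; first exact: nearW.
by move=> v; apply: C1at_cts; exact: cf.
Qed.

Lemma C2_cst (k : R) : C2 (fun _ : X => k).
Proof.
have D v : (fun w : X => 'D_v (fun _ : X => k) w) = fun=> 0.
  by apply/funext => w; exact: derive_cst.
split=> [z|v z|v w z]; first exact: differentiable_cst.
- by rewrite D; exact: C1at_cst.
- by rewrite !D.
Qed.

Lemma deriveE_M f g z v : differentiable f z -> differentiable g z ->
  'D_v (fun w => f w * g w) z = f z * 'D_v g z + g z * 'D_v f z.
Proof. by move=> df dg; apply: deriveM; exact: diff_derivable. Qed.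

Lemma deriveE_D f g z v : differentiable f z -> differentiable g z ->
  'D_v (fun w => f w + g w) z = 'D_v f z + 'D_v g z.
Proof. by move=> df dg; apply: deriveD; exact: diff_derivable. Qed.

Lemma deriveE_B f g z v : differentiable f z -> differentiable g z ->
  'D_v (fun w => f w - g w) z = 'D_v f z - 'D_v g z.
Proof. by move=> df dg; apply: deriveB; exact: diff_derivable. Qed.

Lemma C2M f g : C2 f -> C2 g -> C2 (fun z => f z * g z).
Proof.
move=> Cf Cg; have C1f z := C2_C1at z Cf; have C1g z := C2_C1at z Cg.
move: Cf Cg => [df cf sf] [dg cg sg].
have D v : (fun w => 'D_v (fun z => f z * g z) w) =
           (fun w => f w * 'D_v g w + g w * 'D_v f w).
  by apply/funext => w; rewrite deriveE_M.
have d1 v z : differentiable (fun w => 'D_v f w) z by exact: C1at_diff.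
have d2 v z : differentiable (fun w => 'D_v g w) z by exact: C1at_diff.
split=> [z|v z|v w z]; first exact: differentiableM.
- by rewrite D; apply: C1atD; apply: C1atM.
have E v' w' : 'D_w' (fun y => f y * 'D_v' g y + g y * 'D_v' f y) z =
    f z * 'D_w' (fun y => 'D_v' g y) z + 'D_v' g z * 'D_w' f z +
    (g z * 'D_w' (fun y => 'D_v' f y) z + 'D_v' f z * 'D_w' g z).
  have m1 := deriveE_M w' (df z) (d2 v' z); have m2 := deriveE_M w' (dg z) (d1 v' z).
  exact: etrans (deriveE_D w' (differentiableM (df z) (d2 v' z))
    (differentiableM (dg z) (d1 v' z))) (congr2 +%R m1 m2).
have alg (a b p q p' q' x x' y y' : R) : x = x' -> y = y' ->
    a * x + p * q' + (b * y + q * p') = a * x' + p' * q + (b * y' + q' * p).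
  by move=> -> ->; ring.
by rewrite !D !E; exact: alg (sg v w z) (sf v w z).
Qed.

Lemma C2_prod (I : Type) (r : seq I) (F : I -> X -> R) :
  (forall i, C2 (F i)) -> C2 (fun z => \prod_(i <- r) F i z).
Proof.
move=> CF; elim: r => [|i r IH].
  have -> : (fun z => \prod_(i <- [::]) F i z) = fun=> 1.
    by apply/funext => z; rewrite big_nil.
  exact: C2_cst.
have -> : (fun z => \prod_(j <- i :: r) F j z) = (fun z => F i z * \prod_(j <- r) F j z).
  by apply/funext => z; rewrite big_cons.
exact: C2M (CF i) IH.
Qed.

Lemma C2_onem f : C2 f -> C2 (fun z => 1 - f z).
Proof.
move=> [df cf sf].
have D v : (fun w => 'D_v (fun z => 1 - f z) w) = (fun w => - 'D_v f w).
  apply/funext => w; rewrite deriveE_B//.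
  by rewrite derive_cst sub0r.
have d1 v z : derivable (fun w => 'D_v f w) z v by apply: diff_derivable; exact: C1at_diff.
split=> [z|v z|v w z].
- by apply: differentiableB => //; exact: differentiable_cst.
- by rewrite D; exact: C1atN.
rewrite !D; have dN u u' : 'D_u (fun w => - 'D_u' f w) z = - 'D_u (fun w => 'D_u' f w) z.
  by apply: deriveN; apply: diff_derivable; exact: C1at_diff.
by rewrite !dN sf.
Qed.

Lemma C2_comp_affine (psi psi' psi'' : R -> R) (L : {linear X -> R}) (k c : R) :
  (forall x : R, is_derive x (1 : R) psi (psi' x)) ->
  (forall x : R, is_derive x (1 : R) psi' (psi'' x)) ->
  continuous psi'' -> continuous L -> C2 (fun z => psi (k * L z + c)).
Proof.
move=> d1 d2 c2 cL.
have CL z : C1at (fun z => k * L z + c) z.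
  apply: C1atD; last exact: C1at_cst.
  by apply: C1atM; [exact: C1at_cst|exact: C1at_lin].
have dL z : differentiable (fun z => k * L z + c) z by exact: C1at_diff.
have DL v z : 'D_v (fun z => k * L z + c) z = k * L v.
  have l z' : differentiable L z' by exact: linear_differentiable.
  have dk : differentiable (fun z => k * L z) z by exact: differentiableM.
  rewrite deriveE_D// derive_cst addr0 deriveE_M//.
  by rewrite derive_cst mulr0 addr0 deriveE// diff_lin.
have D v : (fun w => 'D_v (fun z => psi (k * L z + c)) w) =
           (fun w => (k * L v) * psi' (k * L w + c)).
  by apply/funext => w; rewrite (derive_comp1 v d1 (dL w)).2 DL mulrC.
have C' z : C1at (fun z => psi' (k * L z + c)) z by exact: (C1at_comp1 c2 d2).
split=> [z|v z|v w z]; first exact: (derive_comp1 0 d1 (dL z)).1.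
- by rewrite D; apply: C1atM => //; exact: C1at_cst.
rewrite !D !deriveE_M ?derive_cst; try exact: C1at_diff; try exact: differentiable_cst.
by rewrite !(derive_comp1 _ d2 (dL z)).2 !DL; ring.
Qed.

End C2.

(** * Real coordinates on C^n and bumps on cubes *)

Section Cspace.
Context {R : realType} {n : nat}.
Local Notation X := (Cspace R n).
Implicit Types (z w : X) (t : 'I_n).

Definition coordA t (z : X) : R := z.1 0 t.
Definition coordB t (z : X) : R := z.2 0 t.

Fact coordA_linear t : linear (coordA t).
Proof. by move=> k u v; rewrite /coordA /= !mxE. Qed.
HB.instance Definition _ t :=
  GRing.isLinear.Build R X R _ (coordA t) (coordA_linear t).

Fact coordB_linear t : linear (coordB t).
Proof. by move=> k u v; rewrite /coordB /= !mxE. Qed.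
HB.instance Definition _ t :=
  GRing.isLinear.Build R X R _ (coordB t) (coordB_linear t).

Lemma cts_coordA t : continuous (coordA t).
Proof.
apply: (@cts_comp _ _ _ (fun z : X => z.1) (fun u : 'rV[R]_n => u 0 t)).
  exact: cts_fst.
exact: coord_continuous.
Qed.

Lemma cts_coordB t : continuous (coordB t).
Proof.
apply: (@cts_comp _ _ _ (fun z : X => z.2) (fun u : 'rV[R]_n => u 0 t)).
  exact: cts_snd.
exact: coord_continuous.
Qed.

Lemma CnormE z : `|z| = Num.max (\big[Num.max/0]_ij `|z.1 ij.1 ij.2|)
                                (\big[Num.max/0]_ij `|z.2 ij.1 ij.2|).
Proof. by rewrite -!mx_normrE. Qed.

Lemma Cnorm_lt z e : 0 < e ->
  (forall t, `|coordA t z| < e /\ `|coordB t z| < e) -> `|z| < e.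
Proof.
move=> e0 ze; rewrite CnormE gt_max; apply/andP; split;
  apply: bigmax_lt => // -[i j] _ /=;
  by rewrite ord1; have [] := ze j.
Qed.

Lemma coord_le z t : `|coordA t z| <= `|z| /\ `|coordB t z| <= `|z|.
Proof.
rewrite CnormE !le_max; split; apply/orP; [left|right].
  exact: (le_bigmax _ (fun ij => `|z.1 ij.1 ij.2|) (0, t)).
exact: (le_bigmax _ (fun ij => `|z.2 ij.1 ij.2|) (0, t)).
Qed.

Lemma coordA_dirA t t' : coordA t (dir_alpha R t') = (t == t')%:R.
Proof. by rewrite /coordA /= mxE eqxx. Qed.

Lemma coordB_dirA t t' : coordB t (dir_alpha R t') = 0.
Proof. by rewrite /coordB /= mxE. Qed.

Lemma coordA_dirB t t' : coordA t (dir_beta R t') = 0.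
Proof. by rewrite /coordA /= mxE. Qed.

Lemma coordB_dirB t t' : coordB t (dir_beta R t') = (t == t')%:R.
Proof. by rewrite /coordB /= mxE eqxx. Qed.

Definition cdir (i : 'I_n + 'I_n) : X :=
  match i with inl t => dir_alpha R t | inr t => dir_beta R t end.

Definition ccoord (i : 'I_n + 'I_n) : {linear X -> R} :=
  match i with inl t => coordA t | inr t => coordB t end.

Lemma cts_ccoord i : continuous (ccoord i).
Proof. by case: i => t; [exact: cts_coordA|exact: cts_coordB]. Qed.

Lemma Csum z : z = \sum_t coordA t z *: dir_alpha R t + \sum_t coordB t z *: dir_beta R t.
Proof.
have fstE (I : Type) (r : seq I) (F : I -> X) : (\sum_(i <- r) F i).1 = \sum_(i <- r) (F i).1.
  by elim/big_rec2: _ => // i y1 y2 _ <-.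
have sndE (I : Type) (r : seq I) (F : I -> X) : (\sum_(i <- r) F i).2 = \sum_(i <- r) (F i).2.
  by elim/big_rec2: _ => // i y1 y2 _ <-.
rewrite [LHS]surjective_pairing [RHS]surjective_pairing /= !fstE !sndE /=.
rewrite [X in _ + X]big1 => [|t _]; last by rewrite scaler0.
rewrite [X in (_, X + _)]big1 => [|t _]; last by rewrite scaler0.
by rewrite addr0 add0r -!row_sum_delta.
Qed.

Lemma csum z : z = \sum_i ccoord i z *: cdir i.
Proof. by rewrite big_sumType/= [LHS]Csum. Qed.

(** Passes from the coordinate directions, all that [C1_on] speaks of, to derivatives in every
    direction. *)
Lemma Cspace_C1at (f : X -> R) (W : set X) : open W ->
  (forall t v, v = dir_alpha R t \/ v = dir_beta R t -> forall z, W z ->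
     derivable f z v /\ {for z, continuous (fun w => 'D_v f w)}) ->
  forall z, W z -> C1at f z.
Proof.
move=> oW Hf; apply: (partials_C1at cts_ccoord csum oW) => -[t|t] w Ww.
- by apply: (Hf t) => //; left.
- by apply: (Hf t) => //; right.
Qed.

Lemma derive_Cspace (f : X -> R) z v : differentiable f z ->
  'D_v f z = \sum_t (coordA t v * 'D_(dir_alpha R t) f z +
                     coordB t v * 'D_(dir_beta R t) f z).
Proof.
by move=> df; rewrite (derive_coord csum v df) big_sumType/= big_split.
Qed.

Lemma near_seq (T : topologicalType) (I : eqType) (s : seq I) (P : I -> T -> Prop) (x : T) :
  (forall i, i \in s -> \forall y \near x, P i y) ->
  \forall y \near x, forall i, i \in s -> P i y.
Proof.
elim: s => [|i s IH] H; first exact: nearW.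
have h1 := H i (mem_head _ _).
have h2 := IH (fun j js => H j (mem_behead (s := i :: s) js)).
near=> y => j; rewrite in_cons => /predU1P[->|js]; first by near: y.
by move: j js; near: y.
Unshelve. all: by end_near. Qed.

Lemma seq_argmax (I : eqType) (s : seq I) (F : I -> R) (i0 : I) : i0 \in s ->
  exists2 i, i \in s & forall j, j \in s -> F j <= F i.
Proof.
elim: s i0 => // i s IH i0 _; case: s IH => [|k s] IH.
  by exists i; [exact: mem_head|move=> j; rewrite inE => /eqP->].
have [m ms mP] := IH k (mem_head _ _).
have [mi|im] := leP (F m) (F i).
  exists i; first exact: mem_head.
  by move=> j; rewrite in_cons => /predU1P[->//|/mP]/le_trans; exact.
exists m; first by rewrite in_cons ms orbT.
by move=> j; rewrite in_cons => /predU1P[->|/mP//]; exact: ltW.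
Qed.

(** The norm is the sup norm over the real coordinates, so balls are cubes and a product of
    one-variable bumps is a bump; 2 and 5 are the radii of [bump1]. The function [b] is fixed before
    the centre and the size, so that it can be indexed by the points of a cover. *)
Lemma box_bump : exists b : X -> R -> X -> R, forall c d, 0 < d ->
  [/\ C2 (b c d),
      forall z, `|z - c| <= 2 * d -> b c d z = 1 &
      forall z, 5 * d <= `|z - c| -> b c d z = 0].
Proof.
have [psi [psi' [psi'' [d1 d2 c2 psi1 psi0]]]] := @bump1 R.
exists (fun c d z => \prod_t (psi (d^-1 * coordA t z + (- (d^-1 * coordA t c))) *
                              psi (d^-1 * coordB t z + (- (d^-1 * coordB t c))))).
move=> c d dgt0.
have nd (L : {linear X -> R}) z : `|d^-1 * L z + - (d^-1 * L c)| = d^-1 * `|L (z - c)|.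
  by rewrite -mulrBr -linearB normrM ger0_norm// invr_ge0 ltW.
split.
- apply: C2_prod => t; apply: C2M; apply: C2_comp_affine (d1) d2 c2 _.
    exact: cts_coordA.
  exact: cts_coordB.
- move=> z zc; rewrite big1// => t _.
  have [hA hB] := coord_le (z - c) t.
  rewrite !psi1 ?mulr1// nd mulrC ler_pdivrMr//.
    exact: le_trans hB zc.
  exact: le_trans hA zc.
- move=> z zc.
  have [t ht] : exists t, 5 * d <= `|coordA t (z - c)| \/ 5 * d <= `|coordB t (z - c)|.
    apply: contrapT => H; have : `|z - c| < 5 * d.
      apply: Cnorm_lt => [|t]; first by rewrite mulr_gt0.
      by split; rewrite ltNge; apply/negP => h; apply: H; exists t; [left|right].
    by rewrite ltNge zc.
  rewrite (bigD1 t)//=; case: ht => ht.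
    by rewrite psi0 ?mul0r// nd mulrC ler_pdivlMr.
  by rewrite [psi (_ + - (_ * coordB t c))]psi0 ?mulr0 ?mul0r// nd mulrC ler_pdivlMr.
Qed.

End Cspace.

Section Cutoff.
Context {R : realType} {n : nat}.
Local Notation X := (Cspace R n).

(* The product of pointed topological spaces lacks a canonical pointed instance. *)
Lemma compact_cover_Cspace (K : set X) : compact K -> cover_compact K.
Proof.
pose P : ptopologicalType := HB.pack_for ptopologicalType
  ('rV[R]_n * 'rV[R]_n)%type (isPointed.Build ('rV[R]_n * 'rV[R]_n)%type 0).
by move=> cK; suff : @cover_compact P K by []; rewrite -(@compact_cover P).
Qed.

(** One minus the product of the [1 - b c] over a finite cover of [K] is 1 as soon as one bump is 1,
    and 0 where all bumps vanish. [M] is the largest value of the coordinate on the cubes carrying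
    the bumps; the last clause ensures that the region of agreement beyond [M] meets [E]. *)
Lemma cutoff (K E : set X) (t : 'I_n) : compact K -> open E -> K `<=` E ->
  K !=set0 ->
  exists chi : X -> R, exists M B : R,
  [/\ C2 chi,
      forall z, K z -> \forall w \near z, chi w = 1,
      forall z, ~ E z -> \forall w \near z, chi w = 0,
      (forall z, B < `|z| -> chi z = 0) /\ (forall z, M < coordA t z -> chi z = 0) &
      exists2 p, E p & M < coordA t p].
Proof.
move=> cK oE KE [k0 Kk0].
have [b bP] := @box_bump R n.
(* Cubes of size [6 * d] fit in [E] while the bumps live in cubes of size [5 * d]: the margin makes
   the cutoff vanish near each point outside [E], and leaves room for a point of [E] beyond [M]. *)
have /choice[d dP] : forall c : X, exists d : R, 0 < d /\
    (E c -> forall w, `|w - c| < 6 * d -> E w).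
  move=> c.
  have [Ec|nEc] := pselect (E c); last by exists 1.
  have /nbhs_ballP[e /= e0 eE] : nbhs c E by exact: open_nbhs_nbhs.
  exists (e / 6); split=> [|_ w wc]; first by rewrite divr_gt0.
  by apply: eE; rewrite -ball_normE/= distrC; move: wc; rewrite mulrC divfK.
have [s sK sC] : exists2 s : seq X, (forall c, c \in s -> K c) &
    forall z, K z -> exists2 c, c \in s & `|z - c| < 2 * d c.
  move: cK => /compact_cover_Cspace/(_ X K (fun c => ball c (2 * d c))).
  case=> [c _||D DK cD]; first exact: ball_open.
    by move=> z Kz; exists z => //; apply: ballxx; rewrite mulr_gt0// (dP z).1.
  exists D => [c cD'|z /cD[c /= cD' zc]]; first exact: set_mem (DK c cD').
  by exists c => //; move: zc; rewrite -ball_normE/= distrC.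
have [i0 i0s _] := sC k0 Kk0.
have [m ms mP] := seq_argmax (fun c => coordA t c + 5 * d c) i0s.
pose S := \sum_(c <- s) (`|c| + 5 * d c).
have SP c : c \in s -> `|c| + 5 * d c <= S.
  move=> cs; rewrite /S (big_rem _ cs)/= lerDl sumr_ge0// => i _.
  by rewrite addr_ge0// mulr_ge0// ltW// (dP i).1.
have chi0 z : (forall c, c \in s -> 5 * d c <= `|z - c|) ->
    1 - \prod_(c <- s) (1 - b c (d c) z) = 0.
  move=> H; rewrite big_seq big1 ?subrr// => c cs.
  by have [_ _ ->] := bP c (d c) (dP c).1; rewrite ?subr0// H.
exists (fun z => 1 - \prod_(c <- s) (1 - b c (d c) z)), (coordA t m + 5 * d m), S; split.
- apply: C2_onem; apply: (@C2_prod _ _ _ s (fun c z => 1 - b c (d c) z)) => c.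
  by apply: C2_onem; have [] := bP c (d c) (dP c).1.
- move=> z /sC[c cs zc].
  have : \forall w \near z, ball c (2 * d c) w.
    by apply: open_nbhs_nbhs; split; [exact: ball_open|rewrite -ball_normE/= distrC].
  apply: filterS => w; rewrite -ball_normE/= distrC => wc.
  rewrite (big_rem _ cs)/=; have [_ bE _] := bP c (d c) (dP c).1.
  rewrite bE; last exact: ltW.
  by rewrite subrr mul0r subr0.
- move=> z nEz.
  have : \forall w \near z, forall c, c \in s -> 5 * d c <= `|w - c|.
    apply: near_seq => c cs.
    have d0 := (dP c).1.
    have zc : 6 * d c <= `|z - c|.
      by rewrite leNgt; apply/negP => H; apply: nEz; apply: (dP c).2 H; exact/KE/sK.
    apply/nbhs_ballP; exists (d c) => //= w; rewrite -ball_normE/= => zw.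
    have := ler_normD (z - w) (w - c); rewrite addrA subrK => tri.
    lra.
  exact: filterS.
- split=> z hz; apply: chi0 => c cs.
    have := ler_normD (z - c) c; rewrite subrK; have := SP c cs; lra.
  have := mP c cs; have [+ _] := coord_le (z - c) t; rewrite linearB/=.
  by rewrite ler_norml => /andP[_]; lra.
- have d0 := (dP m).1.
  (* A factor strictly between 5 and 6: beyond [M], but still inside [E]. *)
  exists (m + (11 / 2 * d m) *: dir_alpha R t).
    apply: (dP m).2; first exact/KE/sK.
    rewrite addrC addKr; apply: Cnorm_lt => [|t']; first by rewrite mulr_gt0.
    rewrite !linearZ/= coordA_dirA coordB_dirA /GRing.scale/= mulr0 normr0.
    split; last by rewrite mulr_gt0.
    by case: (t' == t); rewrite ?mulr1 ?mulr0 ?normr0 ?ger0_norm; lra.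
  by rewrite linearD linearZ/= coordA_dirA eqxx /GRing.scale/=; lra.
Qed.

End Cutoff.

Definition supp_in (R : realType) (X : normedModType R) (B : R) (f : X -> R) :=
  forall z, B < `|z| -> f z = 0.

(** * The dbar equation and extension *)

Section Cauchy.
Context {R : realType} {X : normedModType R}.
Variables (a b : X) (B0 : R).
(** Quantitative independence of [a] and [b]: a large circle about [z] is far from the origin at
    every angle. *)
Hypothesis circ_far : forall z (r t : R), 0 <= r -> r <= 2 * (`|circ a b z r t| + `|z|).
Implicit Types A B p q : X -> R.

(** By [circ_far], on circles of at least this radius the points have norm at least |B0| + 1, hence
    lie outside the supports. *)
Let rho (z : X) : R := 2 * (`|B0| + 1 + `|z|).

Let rho0 z : 0 <= rho z. Proof. by rewrite mulr_ge0// !addr_ge0. Qed.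

Lemma supp_near (f : X -> R) z : supp_in B0 f -> B0 < `|z| ->
  \forall w \near z, f w = 0.
Proof.
move=> f0 zB; have : \forall w \near z, B0 < `|w|.
  by apply: (cvgr_gt (`|z|)) => //; exact: norm_continuous.
by apply: filterS => w; exact: f0.
Qed.

Lemma supp_derive (f : X -> R) v : supp_in B0 f -> supp_in B0 (fun z => 'D_v f z).
Proof.
move=> f0 z zB; have [-> _] := near_derive v (supp_near f0 zB).
exact: derive_cst.
Qed.

Definition cauchy A B (z : X) : R := polar_int a b (rho z) A B z.

Lemma supp_circ A z r t : supp_in B0 A -> rho z <= r -> A (circ a b z r t) = 0.
Proof.
move=> A0 hr; apply: A0; have := circ_far z t (le_trans (rho0 z) hr).
have := ler_norm B0; move: hr; rewrite /rho; lra.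
Qed.

Lemma cauchyE A B z r : continuous A -> continuous B ->
  supp_in B0 A -> supp_in B0 B -> rho z <= r ->
  cauchy A B z = polar_int a b r A B z.
Proof.
move=> cA cB sA sB hr; rewrite /cauchy; symmetry; apply: polar_trunc => //.
- by rewrite rho0.
- by move=> s t; exact: supp_circ.
- by move=> s t; exact: supp_circ.
Qed.

(** A radius varying with [z] would obstruct differentiation under the integral; near [z0] the
    constant [rho z0 + 2] dominates it and gives the same value. *)
Lemma cauchy_near A B z0 : continuous A -> continuous B ->
  supp_in B0 A -> supp_in B0 B ->
  \forall z \near z0, polar_int a b (rho z0 + 2) A B z = cauchy A B z.
Proof.
move=> cA cB sA sB.
have : \forall z \near z0, `|z| < `|z0| + 1.
  by apply: (cvgr_lt (`|z0|)); [exact: norm_continuous|rewrite ltrDl].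
apply: filterS => z hz; rewrite (cauchyE (r := rho z0 + 2))//.
by rewrite /rho; lra.
Qed.

Lemma cts_cauchy A B : continuous A -> continuous B ->
  supp_in B0 A -> supp_in B0 B -> continuous (cauchy A B).
Proof.
move=> cA cB sA sB z0; apply: near_cts (cauchy_near z0 cA cB sA sB) _.
by apply: cts_polar => //; rewrite addr_ge0.
Qed.

Lemma cauchy_derive A B z v : (forall w, C1at A w) -> (forall w, C1at B w) ->
  supp_in B0 A -> supp_in B0 B ->
  is_derive z v (cauchy A B) (cauchy (fun w => 'D_v A w) (fun w => 'D_v B w) z).
Proof.
move=> CA CB sA sB.
have cA : continuous A by move=> w; exact: C1at_cts.
have cB : continuous B by move=> w; exact: C1at_cts.
have cA' : continuous (fun w => 'D_v A w) by move=> w; exact: (CA w).2.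
have cB' : continuous (fun w => 'D_v B w) by move=> w; exact: (CB w).2.
have r0 : 0 <= rho z + 2 by rewrite addr_ge0.
have dA w : derivable A w v by apply/diff_derivable/C1at_diff.
have dB w : derivable B w v by apply/diff_derivable/C1at_diff.
have [d D] := polar_derive a b z r0 cA cB cA' cB' dA dB.
have [D' d'] := near_derive v (cauchy_near z cA cB sA sB).
split; first exact: d'.
have rz : rho z <= rho z + 2 by rewrite lerDl.
by rewrite -D' D (cauchyE cA' cB' (supp_derive v sA) (supp_derive v sB) rz).
Qed.

Lemma cauchyD A B A' B' z :
  continuous A -> continuous B -> continuous A' -> continuous B' ->
  cauchy A B z + cauchy A' B' z =
  cauchy (fun w => A w + A' w) (fun w => B w + B' w) z.
Proof.
move=> cA cB cA' cB'.
have E := polar_lin a b 1 1 z (rho0 z) cA cB cA' cB'.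
rewrite [X in X + _]mul1r [X in _ + X]mul1r in E.
have EA (F G : X -> R) : (fun w => 1 * F w + 1 * G w) = (fun w => F w + G w).
  by apply/funext => w; rewrite !mul1r.
rewrite (EA A) (EA B) in E; exact: esym E.
Qed.

Lemma cauchyN A B z : continuous A -> continuous B ->
  - cauchy A B z = cauchy (fun w => - A w) (fun w => - B w) z.
Proof.
move=> cA cB; have E := polar_lin a b (-1) 0 z (rho0 z) cA cB cA cB.
rewrite [X in X + _]mulN1r [X in _ + X]mul0r addr0 in E.
have EA (F : X -> R) : (fun w => -1 * F w + 0 * F w) = (fun w => - F w).
  by apply/funext => w; rewrite mulN1r mul0r addr0.
rewrite (EA A) (EA B) in E; exact: esym E.
Qed.

Lemma eq_cauchy A B A' B' z : A =1 A' -> B =1 B' ->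
  cauchy A B z = cauchy A' B' z.
Proof. by move=> /funext -> /funext ->. Qed.

Lemma cauchy_pompeiu p q z : (forall w, C1at p w) -> (forall w, C1at q w) ->
  supp_in B0 p ->
  cauchy (fun w => 'D_a p w - 'D_b q w) (fun w => 'D_a q w + 'D_b p w) z =
  - (p z * (pi *+ 2)).
Proof. by move=> Cp Cq sp; apply: pompeiu => // t; exact: supp_circ. Qed.

Lemma cauchy_le A B M z : continuous A -> continuous B ->
  (forall w, `|A w| <= M) -> (forall w, `|B w| <= M) ->
  `|cauchy A B z| <= (M + M) * (pi *+ 2) * (2 * (`|B0| + 1 + `|z|)).
Proof. by move=> cA cB; apply: polar_le. Qed.

Lemma cauchy_eq0 A B z : (forall r t, A (circ a b z r t) = 0) ->
  (forall r t, B (circ a b z r t) = 0) -> cauchy A B z = 0.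
Proof.
move=> A0 B0'; rewrite /cauchy /polar_int.
rewrite (@eq_intg _ _ _ _ (fun=> 0)) ?intg_cst ?mul0r// => r _.
have p0 : 0 <= pi *+ 2 :> R by rewrite mulrn_wge0// pi_ge0.
rewrite (@eq_intg _ _ _ _ (fun=> 0)) ?intg_cst ?mul0r// => t _.
by rewrite A0 B0' !mulr0 addr0.
Qed.

End Cauchy.

Lemma derive_cutoff (R : realType) (X : normedModType R) (chi f u : X -> R) (z v : X) :
  differentiable chi z -> differentiable f z -> differentiable u z ->
  'D_v (fun w => (1 - chi w) * f w + u w) z =
  (1 - chi z) * 'D_v f z - f z * 'D_v chi z + 'D_v u z.
Proof.
move=> dc df du.
have d1 : differentiable (fun w => 1 - chi w) z by exact: differentiableB.
have dM : differentiable (fun w => (1 - chi w) * f w) z by exact: differentiableM.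
rewrite deriveE_D// deriveE_M// deriveE_B//.
by rewrite derive_cst sub0r mulrN.
Qed.

Section Holomorphic.
Context {R : realType} {n : nat}.
Local Notation X := (Cspace R n).
Local Notation eA := (dir_alpha R).
Local Notation eB := (dir_beta R).

(** In the sup norm both |r cos t| and |r sin t| are at most |w - z|, and |cos t| + |sin t| >= 1. *)
Lemma circ_far_Cspace (t0 : 'I_n) (z : X) (r t : R) : 0 <= r ->
  r <= 2 * (`|circ (eA t0) (eB t0) z r t| + `|z|).
Proof.
move=> r0; set w := circ _ _ _ _ _.
have E : w - z = (r * cos t) *: eA t0 + (r * sin t) *: eB t0.
  by rewrite /w /circ addrC addKr.
have [h1 _] := coord_le (w - z) t0; have [_ h2] := coord_le (w - z) t0.
move: h1 h2; rewrite {1 3}E !linearD !linearZ /= coordA_dirA coordA_dirB.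
rewrite coordB_dirA coordB_dirB eqxx /GRing.scale/= !mulr1 !mulr0 addr0 add0r.
rewrite !normrM (ger0_norm r0) => h1 h2.
have tri : `|w - z| <= `|w| + `|z| by rewrite (le_trans (ler_normD _ _))// normrN.
have cs : 1 <= `|cos t| + `|sin t|.
  have := cos2Dsin2 t; rewrite -[cos t ^+ 2]real_normK ?num_real//.
  rewrite -[sin t ^+ 2]real_normK ?num_real// => H.
  have a0 := normr_ge0 (cos t); have b0 := normr_ge0 (sin t); nra.
have : r <= r * (`|cos t| + `|sin t|) by rewrite ler_peMr.
rewrite mulrDr; lra.
Qed.

Definition hol (W : set X) (p q : X -> R) := forall z, W z ->
  [/\ C1at p z, C1at q z &
      forall t, 'D_(eA t) p z = 'D_(eB t) q z /\ 'D_(eB t) p z = - 'D_(eA t) q z].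

(** * The dbar equation with data of bounded support *)

Section DbarSolve.
Variables (g1 g2 : 'I_n -> X -> R) (t1 : 'I_n) (B : R).
Hypotheses (C1g1 : forall t z, C1at (g1 t) z) (C1g2 : forall t z, C1at (g2 t) z).
Hypotheses (supp_g1 : forall t, supp_in B (g1 t)) (supp_g2 : forall t, supp_in B (g2 t)).
(** With g_t = g1 t + i g2 t, these are the real and imaginary parts of dbar_t g_{t1} = dbar_{t1}
    g_t, up to the factor 2. Only the variable of integration [t1] has to be compared with the
    others. *)
Hypothesis closed_g : forall t z,
  'D_(eA t) (g1 t1) z - 'D_(eB t) (g2 t1) z = 'D_(eA t1) (g1 t) z - 'D_(eB t1) (g2 t) z /\
  'D_(eA t) (g2 t1) z + 'D_(eB t) (g1 t1) z = 'D_(eA t1) (g2 t) z + 'D_(eB t1) (g1 t) z.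

Let cau (f g : X -> R) := cauchy (eA t1) (eB t1) B f g.
(** The sign and the factor undo those of Pompeiu's formula. In the pair [u1], [u2], the second
    transform has data [g2], [- g1] because Im (e^{-it} (g1 + i g2)) = cos t g2 - sin t g1. *)
Let kpi : R := - (pi *+ 2)^-1.
Let u1 z := kpi * cau (g1 t1) (g2 t1) z.
Let u2 z := kpi * cau (g2 t1) (fun w => - g1 t1 w) z.

Let cts1' (f : X -> R) v : (forall z, C1at f z) -> continuous (fun z => 'D_v f z).
Proof. by move=> Cf z; exact: (Cf z).2. Qed.

Let far := @circ_far_Cspace t1.

Let is_derive_u (f g : X -> R) z v : (forall z, C1at f z) -> (forall z, C1at g z) ->
  supp_in B f -> supp_in B g ->
  is_derive z v (fun z => kpi * cau f g z)
    (kpi * cau (fun w => 'D_v f w) (fun w => 'D_v g w) z).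
Proof. by move=> Cf Cg sf sg; apply: is_deriveZ; exact: (cauchy_derive far). Qed.

Let C1at_u (f g : X -> R) z : (forall z, C1at f z) -> (forall z, C1at g z) ->
  supp_in B f -> supp_in B g -> C1at (fun z => kpi * cau f g z) z.
Proof.
move=> Cf Cg sf sg; apply: (@Cspace_C1at _ _ _ setT) => //; first exact: openT.
move=> _ v _ w _; split; first by have [] := is_derive_u w v Cf Cg sf sg.
have -> : (fun w => 'D_v (fun z => kpi * cau f g z) w) =
          (fun w => kpi * cau (fun w => 'D_v f w) (fun w => 'D_v g w) w).
  by apply/funext => y; have [] := is_derive_u y v Cf Cg sf sg.
apply: ctsM; first exact: cts_cst.
by apply: (cts_cauchy far); [exact: cts1'|exact: cts1'|exact: supp_derive|exact: supp_derive].
Qed.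

Let C1Ng1 t z : C1at (fun w => - g1 t w) z. Proof. exact: C1atN. Qed.

Let supp_Ng1 t : supp_in B (fun w => - g1 t w).
Proof. by move=> z zB; rewrite supp_g1// oppr0. Qed.

Let dNg1 v t : (fun w => 'D_v (fun w => - g1 t w) w) = (fun w => - 'D_v (g1 t) w).
Proof. by apply/funext => w; apply: deriveN; apply/diff_derivable/C1at_diff. Qed.

Let du1 v z : 'D_v u1 z =
  kpi * cau (fun w => 'D_v (g1 t1) w) (fun w => 'D_v (g2 t1) w) z.
Proof. by have [] := is_derive_u z v (C1g1 t1) (C1g2 t1) (supp_g1 t1) (supp_g2 t1). Qed.

Let du2 v z : 'D_v u2 z =
  kpi * cau (fun w => 'D_v (g2 t1) w) (fun w => - 'D_v (g1 t1) w) z.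
Proof.
have [_] := is_derive_u z v (C1g2 t1) (C1Ng1 t1) (supp_g2 t1) (supp_Ng1 t1).
by rewrite dNg1.
Qed.

Let kpiE x : kpi * - (x * (pi *+ 2)) = x.
Proof.
by rewrite /kpi mulrN mulNr opprK mulrC mulfK// mulrn_eq0/= gt_eqF// pi_gt0.
Qed.

(** The operator 2 dbar_t moves under the integral onto g_{t1}; closedness turns the result into 2
    dbar_{t1} g_t, a derivative in the plane of integration, where Pompeiu's formula gives back
    g_t. *)
Let dbar_u t z : 'D_(eA t) u1 z - 'D_(eB t) u2 z = g1 t z /\
                 'D_(eA t) u2 z + 'D_(eB t) u1 z = g2 t z.
Proof.
have c1 v s : continuous (fun w => 'D_v (g1 s) w) by exact: cts1'.
have c2 v s : continuous (fun w => 'D_v (g2 s) w) by exact: cts1'.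
have c1N v s : continuous (fun w => - 'D_v (g1 s) w) by apply: ctsN.
have c2N v s : continuous (fun w => - 'D_(v) (g2 s) w) by apply: ctsN.
have c1NN v s : continuous (fun w => - - 'D_v (g1 s) w) by apply: ctsN.
split.
  transitivity (kpi * - (g1 t z * (pi *+ 2))); last exact: kpiE.
  rewrite [X in X - _]du1 [X in _ - X]du2 -mulrBr; apply: (f_equal (GRing.mul kpi)).
  rewrite -(cauchy_pompeiu far z (C1g1 t) (C1g2 t) (supp_g1 t)).
  have N := cauchyN (eA t1) (eB t1) B z (c2 (eB t) t1) (c1N (eB t) t1).
  have D := cauchyD (eA t1) (eB t1) B z (c1 (eA t) t1) (c2 (eA t) t1)
    (c2N (eB t) t1) (c1NN (eB t) t1).
  apply: (etrans (congr1 (fun x => cau _ _ z + x) N)); apply: (etrans D).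
  apply: eq_cauchy => w; first exact: (closed_g t w).1.
  by rewrite opprK; exact: (closed_g t w).2.
transitivity (kpi * - (g2 t z * (pi *+ 2))); last exact: kpiE.
rewrite [X in X + _]du2 [X in _ + X]du1 -mulrDr; apply: (f_equal (GRing.mul kpi)).
rewrite -(cauchy_pompeiu far z (C1g2 t) (C1Ng1 t) (supp_g2 t)).
have D := cauchyD (eA t1) (eB t1) B z (c2 (eA t) t1) (c1N (eA t) t1)
  (c1 (eB t) t1) (c2 (eB t) t1).
apply: (etrans D).
have E v w : 'D_v (fun w => - g1 t w) w = - 'D_v (g1 t) w.
  by apply: deriveN; apply/diff_derivable/C1at_diff.
apply: eq_cauchy => w.
  by rewrite E opprK; exact: (closed_g t w).2.
have neg (x y x' y' : R) : x - y = x' - y' -> - x + y = - x' + y'.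
  by move=> h; rewrite addrC -opprB h opprB addrC.
by rewrite E; apply: neg; exact: (closed_g t w).1.
Qed.

(** The last clause holds because integration moves only the coordinate [t1]: beyond [M] in another
    coordinate the data vanish on the whole plane of integration. *)
Lemma dbar_solve : exists v1 v2 : X -> R,
  [/\ forall z, C1at v1 z, forall z, C1at v2 z,
      forall t z, 'D_(eA t) v1 z - 'D_(eB t) v2 z = g1 t z /\
                  'D_(eA t) v2 z + 'D_(eB t) v1 z = g2 t z &
      forall t2 M, t1 != t2 ->
        (forall w, M < coordA t2 w -> g1 t1 w = 0 /\ g2 t1 w = 0) ->
        forall z, M < coordA t2 z -> v1 z = 0 /\ v2 z = 0].
Proof.
exists u1, u2; split => [z|z|t z|t2 M t12 g0 z Mz].
- exact: C1at_u.
- exact: C1at_u.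
- exact: dbar_u.
have cM r s : M < coordA t2 (circ (eA t1) (eB t1) z r s).
  rewrite /circ !linearD !linearZ/= coordA_dirA coordA_dirB eq_sym (negbTE t12).
  by rewrite /GRing.scale/= !mulr0 !addr0.
have g0' r s := g0 _ (cM r s).
split; rewrite /u1 /u2 /cau cauchy_eq0 ?mulr0// => r s.
- by have [] := g0' r s.
- by have [] := g0' r s.
- by have [] := g0' r s.
- by have [-> _] := g0' r s; rewrite oppr0.
Qed.

End DbarSolve.

(** * Extension of a scalar holomorphic function *)

Section Extension.
Variables (W E : set X) (chi p q : X -> R) (t1 t2 : 'I_n) (M B : R).
Hypotheses (t12 : t1 != t2) (holpq : hol W p q) (oW : open W) (Cchi : C2 chi).
Hypothesis chi1 : forall z, E z -> ~ W z -> \forall w \near z, chi w = 1.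
Hypothesis chi0 : forall z, ~ E z -> \forall w \near z, chi w = 0.
Hypothesis chiB : supp_in B chi.
Hypothesis chiM : forall z, M < coordA t2 z -> chi z = 0.

(* The real and imaginary parts of [2 dbar_t chi * (p + i q)]. *)
Let g1 t z := 'D_(eA t) chi z * p z - 'D_(eB t) chi z * q z.
Let g2 t z := 'D_(eA t) chi z * q z + 'D_(eB t) chi z * p z.

Let dchi_near z v : ~ W z -> \forall w \near z, 'D_v chi w = 0.
Proof.
move=> nW; have [k /nbhs_interior hk] : exists k, \forall w \near z, chi w = k.
  by have [Ez|nE] := pselect (E z); [exists 1; exact: chi1|exists 0; exact: chi0].
apply: filterS hk => w hw; have [-> _] := near_derive v hw; exact: derive_cst.
Qed.

Let C1chi z : C1at chi z. Proof. exact: C2_C1at. Qed.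

Let C1dchi v z : C1at (fun w => 'D_v chi w) z. Proof. by case: Cchi. Qed.

(** [p] and [q] are total functions with arbitrary values outside [W]. The derivatives of the cutoff
    vanish near such points, so the products already are the extension by zero. *)
Let g_out t z : ~ W z -> (\forall w \near z, g1 t w = 0) /\ (\forall w \near z, g2 t w = 0).
Proof.
move=> nW; have hA := dchi_near (eA t) nW; have hB := dchi_near (eB t) nW.
by split; near=> w; rewrite /g1 /g2 (near hA w _)// (near hB w _)// !mul0r ?subrr ?addr0.
Unshelve. all: by end_near. Qed.

Let C1g t z : C1at (g1 t) z /\ C1at (g2 t) z.
Proof.
have [Wz|nW] := pselect (W z).
  have [Cp Cq _] := holpq Wz.
  split; first exact: (C1atB (C1atM (C1dchi _ z) Cp) (C1atM (C1dchi _ z) Cq)).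
  exact: (C1atD (C1atM (C1dchi _ z) Cq) (C1atM (C1dchi _ z) Cp)).
have [h1 h2] := g_out t nW; split.
- by apply: (@C1at_near _ _ (fun=> 0)); [apply: filterS h1 => w ->|exact: C1at_cst].
- by apply: (@C1at_near _ _ (fun=> 0)); [apply: filterS h2 => w ->|exact: C1at_cst].
Qed.

Let C1g1 t z : C1at (g1 t) z. Proof. by have [] := C1g t z. Qed.
Let C1g2 t z : C1at (g2 t) z. Proof. by have [] := C1g t z. Qed.

Let dg t v z : W z ->
  'D_v (g1 t) z = 'D_(eA t) chi z * 'D_v p z + p z * 'D_v (fun w => 'D_(eA t) chi w) z
    - ('D_(eB t) chi z * 'D_v q z + q z * 'D_v (fun w => 'D_(eB t) chi w) z) /\
  'D_v (g2 t) z = 'D_(eA t) chi z * 'D_v q z + q z * 'D_v (fun w => 'D_(eA t) chi w) z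
    + ('D_(eB t) chi z * 'D_v p z + p z * 'D_v (fun w => 'D_(eB t) chi w) z).
Proof.
move=> Wz; have [/C1at_diff dp /C1at_diff dq _] := holpq Wz.
have d u : differentiable (fun w => 'D_u chi w) z by exact: C1at_diff.
by split; rewrite /g1 /g2 ?deriveE_B ?deriveE_D ?deriveE_M//; apply: differentiableM.
Qed.

Let eq_sub4 (a b c d a' b' c' d' : R) : a = a' -> b = b' -> c = c' -> d = d' ->
  a' - b' = c' - d' -> a - b = c - d.
Proof. by move=> -> -> -> ->. Qed.

Let eq_add4 (a b c d a' b' c' d' : R) : a = a' -> b = b' -> c = c' -> d = d' ->
  a' + b' = c' + d' -> a + b = c + d.
Proof. by move=> -> -> -> ->. Qed.

(** For holomorphic f = P + i Q, 2 dbar ((1 - chi) f + u) = 2 dbar u - 2 f dbar chi; the last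
    hypothesis makes its real part vanish. Final letters [A] and [B] mark derivatives in alpha and
    beta. *)
Let glue_re (k cA cB pA qB P Q uA vB GA HB : R) :
  GA = k * pA - P * cA + uA -> HB = k * qB - Q * cB + vB ->
  pA = qB -> uA - vB = cA * P - cB * Q -> GA = HB.
Proof. by move=> -> -> -> /eqP; rewrite subr_eq => /eqP ->; ring. Qed.

Let glue_im (k cA cB pB qA P Q uB vA GB HA : R) :
  GB = k * pB - P * cB + uB -> HA = k * qA - Q * cA + vA ->
  pB = - qA -> vA + uB = cA * Q + cB * P -> GB = - HA.
Proof.
move=> -> -> -> h; have -> : uB = cA * Q + cB * P - vA by rewrite -h; ring.
ring.
Qed.

Section ClosedAlgebra.
Variables (P Q cA cB c1A c1B pA pB qA qB p1A p1B q1A q1B : R).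
Variables (cAA cAB cBA cBB cAA' cAB' cBA' cBB' : R).
Hypotheses (a1 : pA = qB) (a2 : pB = - qA) (b1 : p1A = q1B) (b2 : p1B = - q1A).
Hypotheses (s1 : cAA = cAA') (s2 : cAB = cAB') (s3 : cBA = cBA') (s4 : cBB = cBB').

(** As f = P + i Q is holomorphic, dbar_t (f dbar_{t1} chi) = f dbar_t dbar_{t1} chi, which is
    symmetric in t and t1. The digit 1 marks derivatives in [t1]; primed letters are second
    derivatives in the other order. *)
Lemma closed_re :
  c1A * pA + P * cAA - (c1B * qA + Q * cBA) -
    (c1A * qB + Q * cAB + (c1B * pB + P * cBB)) =
  cA * p1A + P * cAA' - (cB * q1A + Q * cAB') -
    (cA * q1B + Q * cBA' + (cB * p1B + P * cBB')).
Proof. by rewrite a1 a2 b1 b2 s1 s2 s3 s4; ring. Qed.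

Lemma closed_im :
  c1A * qA + Q * cAA + (c1B * pA + P * cBA) +
    (c1A * pB + P * cAB - (c1B * qB + Q * cBB)) =
  cA * q1A + Q * cAA' + (cB * p1A + P * cAB') +
    (cA * p1B + P * cBA' - (cB * q1B + Q * cBB')).
Proof. by rewrite a1 a2 b1 b2 s1 s2 s3 s4; ring. Qed.

End ClosedAlgebra.

Let closed_g t z :
  'D_(eA t) (g1 t1) z - 'D_(eB t) (g2 t1) z = 'D_(eA t1) (g1 t) z - 'D_(eB t1) (g2 t) z /\
  'D_(eA t) (g2 t1) z + 'D_(eB t) (g1 t1) z = 'D_(eA t1) (g2 t) z + 'D_(eB t1) (g1 t) z.
Proof.
have [Wz|nW] := pselect (W z); last first.
  have g10 s v : 'D_v (g1 s) z = 0.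
    have [h1 _] := g_out s nW; have [-> _] := near_derive v h1; exact: derive_cst.
  have g20 s v : 'D_v (g2 s) z = 0.
    have [_ h2] := g_out s nW; have [-> _] := near_derive v h2; exact: derive_cst.
  split; first by apply: eq_sub4 (g10 _ _) (g20 _ _) (g10 _ _) (g20 _ _) _.
  by apply: eq_add4 (g20 _ _) (g10 _ _) (g20 _ _) (g10 _ _) _.
have [_ _ CR] := holpq Wz; have [_ _ sym] := Cchi.
have [a1 a2] := CR t; have [b1 b2] := CR t1.
have s1 := sym (eA t1) (eA t) z; have s2 := sym (eA t1) (eB t) z.
have s3 := sym (eB t1) (eA t) z; have s4 := sym (eB t1) (eB t) z.
have d1 s v := (dg s v Wz).1; have d2 s v := (dg s v Wz).2.
split.
  apply: eq_sub4 (d1 _ _) (d2 _ _) (d1 _ _) (d2 _ _) _.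
  exact: closed_re _ _ _ _ _ _ a1 a2 b1 b2 s1 s2 s3 s4.
apply: eq_add4 (d2 _ _) (d1 _ _) (d2 _ _) (d1 _ _) _.
exact: closed_im _ _ _ _ _ _ a1 a2 b1 b2 s1 s2 s3 s4.
Qed.

Let supp_g t : supp_in B (g1 t) /\ supp_in B (g2 t).
Proof.
have s v := supp_derive v chiB.
by split=> z zB; rewrite /g1 /g2 !s// !mul0r ?subrr ?addr0.
Qed.

Let supp_g1 t : supp_in B (g1 t). Proof. by have [] := supp_g t. Qed.
Let supp_g2 t : supp_in B (g2 t). Proof. by have [] := supp_g t. Qed.

Lemma scalar_extension : exists G1 G2 : X -> R, hol E G1 G2 /\
  forall z, M < coordA t2 z -> G1 z = p z /\ G2 z = q z.
Proof.
have [u1 [u2 [C1u1 C1u2 dbar_u u0]]] :=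
  dbar_solve C1g1 C1g2 supp_g1 supp_g2 closed_g.
have g0 w : M < coordA t2 w -> g1 t1 w = 0 /\ g2 t1 w = 0.
  move=> Mw; have d0 v : 'D_v chi w = 0.
    have : \forall y \near w, chi y = 0.
      have : \forall y \near w, M < coordA t2 y.
        exact: (@cvgr_gt _ _ _ _ (coordA t2) _ (@cts_coordA R n t2 w) _ Mw).
      by apply: filterS => y; exact: chiM.
    by move/(near_derive v) => [-> _]; exact: derive_cst.
  by rewrite /g1 /g2 !d0 !mul0r subrr addr0.
pose G (f u : X -> R) z := (1 - chi z) * f z + u z.
exists (G p u1), (G q u2); split=> [z Ez|z Mz]; last first.
  by have [h1 h2] := u0 t2 M t12 g0 z Mz; rewrite /G chiM// h1 h2 subr0 !mul1r !addr0.
have C1c : C1at (fun w => 1 - chi w) z by apply: C1atB => //; exact: C1at_cst.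
(* Outside [W] the cutoff is 1 nearby, so the glued function is just [u], which satisfies the
   Cauchy-Riemann equations there since its data vanish. *)
have [Wz|nW] := pselect (W z); last first.
  have E1 f u : \forall w \near z, u w = G f u w.
    by apply: filterS (chi1 Ez nW) => w; rewrite /G => ->; rewrite subrr mul0r add0r.
  have E1' f u := filterS (fun w => esym) (E1 f u).
  split; [exact: C1at_near (C1u1 z)|exact: C1at_near (C1u2 z)|].
  move=> t; have [h1 h2] := g_out t nW; have [e1 e2] := dbar_u t z.
  have [A1 _] := near_derive (eA t) (E1 p u1); have [B1 _] := near_derive (eB t) (E1 p u1).
  have [A2 _] := near_derive (eA t) (E1 q u2); have [B2 _] := near_derive (eB t) (E1 q u2).
  rewrite -A1 -A2 -B1 -B2; split.
    by apply/eqP; rewrite -subr_eq0 e1 (nbhs_singleton h1).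
  by apply/eqP; rewrite -addr_eq0 addrC e2 (nbhs_singleton h2).
have [Cp Cq CR] := holpq Wz.
split; [exact: C1atD (C1atM C1c Cp) (C1u1 z)|exact: C1atD (C1atM C1c Cq) (C1u2 z)|].
move=> t.
have [e1 e2] := dbar_u t z; have [r1 r2] := CR t.
have DG f u v : C1at f z -> C1at u z ->
    'D_v (G f u) z = (1 - chi z) * 'D_v f z - f z * 'D_v chi z + 'D_v u z.
  by move=> /C1at_diff df /C1at_diff du; exact: (derive_cutoff v (C1at_diff (C1chi z)) df du).
split.
  exact: glue_re (DG _ _ _ Cp (C1u1 z)) (DG _ _ _ Cq (C1u2 z)) r1 e1.
exact: glue_im (DG _ _ _ Cp (C1u1 z)) (DG _ _ _ Cq (C1u2 z)) r2 e2.
Qed.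

End Extension.
End Holomorphic.

(** * The identity theorem *)

Section Identity1.
Context {R : realType}.
Local Notation Y := (Cspace R 1).
Local Notation e1 := (dir_alpha R (ord0 : 'I_1)).
Local Notation ei := (dir_beta R (ord0 : 'I_1)).
Local Notation re := (@coordA R 1 ord0).
Local Notation im := (@coordB R 1 ord0).
Implicit Types (z : Y) (p q f : Y -> R).

Lemma bounded_supp f (B : R) : continuous f -> supp_in B f ->
  exists2 C, 0 <= C & forall z, `|f z| <= C.
Proof.
move=> cf sf; pose b := Num.max B 0.
have b0 : 0 <= b by rewrite le_max lexx orbT.
pose g (x : R * R) : Y := x.1 *: e1 + x.2 *: ei.
have cg : continuous g.
  by apply: ctsDv; apply: ctsZ; [exact: cts_fst|exact: cts_snd].
have gE z : z = g (re z, im z) by rewrite /g [LHS]Csum !big_ord1.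
have cI : compact ([set` `[- b, b]] `*` [set` `[- b, b]] : set (R * R)).
  by apply: compact_setX; exact: segment_compact.
have I0 : ([set` `[- b, b]] `*` [set` `[- b, b]] : set (R * R)) !=set0.
  by exists (0, 0); split => /=; rewrite in_itv/= b0 oppr_le0 b0.
have cfg : continuous (fun x => `|f (g x)|).
  by move=> x; apply: cvg_norm; apply: (cts_comp cg cf).
have [c _ cP] := compact_EVT_max I0 cI (continuous_subspaceT cfg).
exists `|f (g c)| => // z.
have [zb|zb] := leP `|z| b; last first.
  rewrite sf ?normr0//; apply: le_lt_trans zb; by rewrite le_max lexx.
rewrite [z in f z]gE; apply: cP; rewrite inE; split => /=; rewrite in_itv/= -ler_norml.
  by apply: le_trans zb; have [] := coord_le z ord0.
by apply: le_trans zb; have [] := coord_le z ord0.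
Qed.

Definition nrm2 z := re z ^+ 2 + im z ^+ 2.

(** The quotient of [f.1 + i f.2] by z, as multiplication by conj z / |z|^2. The value at 0 is 0,
    the right one for a function vanishing near 0. *)
Definition divz (f : (Y -> R) * (Y -> R)) : (Y -> R) * (Y -> R) :=
  (fun z => (f.1 z * re z + f.2 z * im z) * (nrm2 z)^-1,
   fun z => (f.2 z * re z - f.1 z * im z) * (nrm2 z)^-1).

Lemma C1re z : C1at re z. Proof. exact: (C1at_lin z (@cts_coordA R 1 ord0)). Qed.
Lemma C1im z : C1at im z. Proof. exact: (C1at_lin z (@cts_coordB R 1 ord0)). Qed.

Lemma dre v z : 'D_v re z = re v.
Proof.
rewrite deriveE; last exact: C1at_diff (C1re z).
by rewrite (diff_lin z (@cts_coordA R 1 ord0)).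
Qed.

Lemma dim v z : 'D_v im z = im v.
Proof.
rewrite deriveE; last exact: C1at_diff (C1im z).
by rewrite (diff_lin z (@cts_coordB R 1 ord0)).
Qed.

Lemma C1nrm2 z : C1at nrm2 z.
Proof. exact: C1atD (C1atM (C1re z) (C1re z)) (C1atM (C1im z) (C1im z)). Qed.

Lemma nrm2_eq0 z : nrm2 z = 0 -> z = 0.
Proof.
move=> /eqP; rewrite paddr_eq0 ?sqr_ge0// !sqrf_eq0 => /andP[/eqP h1 /eqP h2].
by rewrite [LHS]Csum !big_ord1 h1 h2 !scale0r addr0.
Qed.

Lemma nrm2_ge z : `|z| ^+ 2 <= nrm2 z.
Proof.
have [z0|z0] := eqVneq z 0; first by rewrite z0 normr0 expr0n /= addr_ge0 ?sqr_ge0.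
rewrite leNgt; apply/negP => H.
have s0 : 0 < `|z| by rewrite normr_gt0.
have : `|z| < `|z|; last by rewrite ltxx.
apply: Cnorm_lt => // t; rewrite ord1.
have h (x y : R) : x ^+ 2 + y ^+ 2 < `|z| ^+ 2 -> `|x| < `|z|.
  move=> xy; rewrite -(ltr_pXn2r (n := 2))// ?nnegrE//.
  by rewrite real_normK ?num_real//; apply: le_lt_trans xy; rewrite lerDl sqr_ge0.
split; first exact: h H.
by apply: (h _ (re z)); rewrite addrC.
Qed.

Lemma divz_hol (W : set Y) (f : (Y -> R) * (Y -> R)) : hol W f.1 f.2 ->
  (\forall z \near (0 : Y), f.1 z = 0 /\ f.2 z = 0) ->
  hol W (divz f).1 (divz f).2.
Proof.
move=> hf f0 z Wz.
have [z0|z0] := eqVneq z 0.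
  have D0 : (\forall w \near z, (fun _ : Y => 0 : R) w = (divz f).1 w) /\
            (\forall w \near z, (fun _ : Y => 0 : R) w = (divz f).2 w).
    by rewrite z0; split; apply: filterS f0 => w [h1 h2];
      rewrite /divz/= h1 h2 !mul0r ?subrr ?addr0 ?mul0r.
  have [d1 d2] := D0.
  split; [exact: C1at_near d1 (C1at_cst _ _)|exact: C1at_near d2 (C1at_cst _ _)|].
  move=> t; have [<- _] := near_derive (dir_alpha R t) d1.
  have [<- _] := near_derive (dir_alpha R t) d2.
  have [<- _] := near_derive (dir_beta R t) d1.
  have [<- _] := near_derive (dir_beta R t) d2.
  by rewrite !derive_cst oppr0.
have nz : nrm2 z != 0 by apply/eqP => /nrm2_eq0/eqP; apply/negP.
have [Cp Cq CR] := hf z Wz.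
have Cn := C1atV nz (C1nrm2 z).
split.
- exact: C1atM (C1atD (C1atM Cp (C1re z)) (C1atM Cq (C1im z))) Cn.
- exact: C1atM (C1atB (C1atM Cq (C1re z)) (C1atM Cp (C1im z))) Cn.
move=> t; rewrite (ord1 t).
have [r1 r2] := CR ord0.
have dp := C1at_diff Cp; have dq := C1at_diff Cq.
have dr := C1at_diff (C1re z); have di := C1at_diff (C1im z).
have dn := C1at_diff (C1nrm2 z); have dn' := C1at_diff Cn.
have Dn v : 'D_v nrm2 z = 2 * (re z * re v + im z * im v).
  transitivity ('D_v (fun w => re w * re w + im w * im w) z); first by [].
  rewrite deriveE_D; [|exact: differentiableM..].
  by rewrite !deriveE_M// dre dim; ring.
have Dn' v : 'D_v (fun w => (nrm2 w)^-1) z = - (nrm2 z)^-1 ^+ 2 * 'D_v nrm2 z.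
  by rewrite deriveV ?exprVn//; exact: diff_derivable.
have D1 v : 'D_v (divz f).1 z =
   (f.1 z * re z + f.2 z * im z) * (- (nrm2 z)^-1 ^+ 2 * (2 * (re z * re v + im z * im v)))
   + (nrm2 z)^-1 * (f.1 z * re v + re z * 'D_v f.1 z + (f.2 z * im v + im z * 'D_v f.2 z)).
  rewrite /divz/= deriveE_M//; last first.
    by apply: differentiableD; apply: differentiableM.
  by rewrite Dn' Dn deriveE_D ?deriveE_M ?dre ?dim//; exact: differentiableM.
have D2 v : 'D_v (divz f).2 z =
   (f.2 z * re z - f.1 z * im z) * (- (nrm2 z)^-1 ^+ 2 * (2 * (re z * re v + im z * im v)))
   + (nrm2 z)^-1 * (f.2 z * re v + re z * 'D_v f.2 z - (f.1 z * im v + im z * 'D_v f.1 z)).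
  rewrite /divz/= deriveE_M//; last first.
    by apply: differentiableB; apply: differentiableM.
  by rewrite Dn' Dn deriveE_B ?deriveE_M ?dre ?dim//; exact: differentiableM.
rewrite !D1 !D2 r1 r2 coordA_dirA coordB_dirA coordA_dirB coordB_dirB eqxx.
rewrite /nrm2 in nz *.
move: (f.1 z) (f.2 z) (re z) (im z) ('D_ei f.2 z) ('D_e1 f.2 z) nz.
by move=> P Q x y a b nz; split; field.
Qed.

Let divz_norm (P Q x y N F : R) : N = x ^+ 2 + y ^+ 2 -> 4 <= N ->
  P ^+ 2 + Q ^+ 2 <= F ->
  ((P * x + Q * y) * N^-1) ^+ 2 + ((Q * x - P * y) * N^-1) ^+ 2 <= F / 4.
Proof.
move=> NE N4 PF; have N0 : 0 < N by exact: lt_le_trans N4.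
have -> : ((P * x + Q * y) * N^-1) ^+ 2 + ((Q * x - P * y) * N^-1) ^+ 2 =
    (P ^+ 2 + Q ^+ 2) / N.
  have NE0 : x ^+ 2 + y ^+ 2 != 0 by rewrite -NE gt_eqF.
  by rewrite NE; field.
apply: ler_pM => //; first by rewrite addr_ge0 ?sqr_ge0.
by rewrite invr_ge0 ltW.
by rewrite lef_pV2 ?posrE.
Qed.

(** Division by z^m keeps the value at z = 1, that is at [e1], but divides the squared modulus by at
    least [4 ^+ m] where |z| >= 2: this contrast is what the Cauchy formula exploits. *)
Lemma iter_divz (W : set Y) (f : (Y -> R) * (Y -> R)) m : hol W f.1 f.2 ->
  (\forall z \near (0 : Y), f.1 z = 0 /\ f.2 z = 0) ->
  let g := iter m divz f in
  [/\ hol W g.1 g.2,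
      g.1 e1 = f.1 e1,
      \forall z \near (0 : Y), g.1 z = 0 /\ g.2 z = 0 &
      forall z, 2 <= `|z| ->
        g.1 z ^+ 2 + g.2 z ^+ 2 <= (f.1 z ^+ 2 + f.2 z ^+ 2) / 4 ^+ m].
Proof.
move=> hf f0 /=.
(* The induction also carries the second component at [e1], since division mixes the two. *)
have [] : [/\ hol W (iter m divz f).1 (iter m divz f).2,
      (iter m divz f).1 e1 = f.1 e1 /\ (iter m divz f).2 e1 = f.2 e1,
      \forall z \near (0 : Y), (iter m divz f).1 z = 0 /\ (iter m divz f).2 z = 0 &
      forall z, 2 <= `|z| ->
        (iter m divz f).1 z ^+ 2 + (iter m divz f).2 z ^+ 2 <=
        (f.1 z ^+ 2 + f.2 z ^+ 2) / 4 ^+ m]; last by move=> ? [].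
elim: m => [|m [IH1 [IH2 IH2'] IH3 IH4]] /=.
  by split => // z _; rewrite expr0 divr1.
split.
- exact: divz_hol.
- rewrite /divz/= /nrm2 coordA_dirA coordB_dirA eqxx /= IH2 IH2'.
  by rewrite !mulr0 !mulr1 addr0 subr0 expr0n /= addr0 expr1n invr1 !mulr1.
- by apply: filterS IH3 => z [h1 h2]; rewrite /divz/= h1 h2 !mul0r subrr addr0 mul0r.
move=> z z2; have := IH4 z z2; rewrite /divz/=.
have n4 : 4 <= nrm2 z.
  apply: le_trans (nrm2_ge z); rewrite (_ : 4 = 2 ^+ 2 :> R); last by rewrite -natrX.
  by rewrite ler_pXn2r// ?nnegrE.
have n0 : nrm2 z != 0 by rewrite gt_eqF// (lt_le_trans _ n4).
move=> H; have E : (f.1 z ^+ 2 + f.2 z ^+ 2) / 4 ^+ m / 4 =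
    (f.1 z ^+ 2 + f.2 z ^+ 2) / 4 ^+ m.+1 by rewrite [4 ^+ m.+1]exprSr invfM mulrA.
by rewrite -E; exact: divz_norm (erefl _) n4 H.
Qed.

Let prod_re (c cA cB pA qB P Q A B : R) :
  A = c * pA + P * cA -> B = c * qB + Q * cB -> pA = qB ->
  A - B = cA * P - cB * Q.
Proof. by move=> -> -> ->; ring. Qed.

Let prod_im (c cA cB qA pB P Q A B : R) :
  A = c * qA + Q * cA -> B = c * pB + P * cB -> pB = - qA ->
  A + B = cA * Q + cB * P.
Proof. by move=> -> -> ->; ring. Qed.

Let norm_mul (a b P Q : R) : (a * P - b * Q) ^+ 2 + (a * Q + b * P) ^+ 2 =
  (a ^+ 2 + b ^+ 2) * (P ^+ 2 + Q ^+ 2).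
Proof. by ring. Qed.

Let eq_near0 (f : Y -> R) z : (\forall w \near z, f w = 0) -> C1at f z.
Proof.
by move=> h; apply: C1at_near (C1at_cst 0 z); apply: filterS h => w ->.
Qed.

(** The cutoff is 1 up to radius 2 and 0 from radius 5, so the Cauchy formula at [e1] integrates g
    dbar chi over 2 <= |z| <= 5 only. With g = f / z^m the left side is independent of m, and the
    right side is at most a constant over [2 ^+ m]. Radius 6 leaves a margin around the support. *)
Lemma identity_disc_re (W : set Y) p q : hol W p q ->
  (forall z, `|z| < 6 -> W z) ->
  (\forall z \near (0 : Y), p z = 0 /\ q z = 0) -> p e1 = 0.
Proof.
move=> hpq W6 pq0.
have [b bP] := @box_bump R 1.
have [Cchi chi1 chi0] := bP 0 1 ltr01.
set chi := b 0 1 in Cchi chi1 chi0.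
move: (chi) Cchi chi1 chi0 => {chi bP b} chi Cchi chi1 chi0.
have C1c z : C1at chi z by exact: C2_C1at.
have C1dc v z : C1at (fun w => 'D_v chi w) z by case: Cchi.
have schi : supp_in 5 chi by move=> z /ltW z5; apply: chi0; rewrite subr0 mulr1.
have sdc v : supp_in 5 (fun w => 'D_v chi w) by exact: supp_derive.
have dc0 v z : `|z| < 2 -> 'D_v chi z = 0.
  move=> z2; have : \forall w \near z, chi w = 1.
    have : \forall w \near z, `|w| < 2.
      exact: (@cvgr_lt _ _ _ _ (fun w => `|w|) _ (@norm_continuous _ _ z) _ z2).
    by apply: filterS => w /ltW w2; apply: chi1; rewrite subr0 mulr1.
  by move/(near_derive v) => [-> _]; exact: derive_cst.
have out f z : supp_in 5 f -> ~ W z -> \forall w \near z, f w = 0.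
  move=> sf nW; apply: supp_near sf _.
  apply: lt_le_trans (_ : 6 <= _); first by rewrite ltr_nat.
  by rewrite leNgt; apply/negP => /W6.
have prod f k : supp_in 5 k -> (forall z, C1at k z) -> (forall z, W z -> C1at f z) ->
    supp_in 5 (fun w => k w * f w) /\ forall z, C1at (fun w => k w * f w) z.
  move=> sk Ck Cf.
  have s5 : supp_in 5 (fun w => k w * f w) by move=> w /sk ->; rewrite mul0r.
  split; first exact: s5.
  move=> z; have [Wz|nW] := pselect (W z); first exact: C1atM (Ck z) (Cf z Wz).
  exact: eq_near0 (out _ _ s5 nW).
(* [alpha + i beta] is the product of 2 dbar chi and g, equal on [W] to 2 dbar (chi g) when g is
   holomorphic. *)
pose alpha (g : (Y -> R) * (Y -> R)) z := 'D_e1 chi z * g.1 z - 'D_ei chi z * g.2 z.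
pose beta (g : (Y -> R) * (Y -> R)) z := 'D_e1 chi z * g.2 z + 'D_ei chi z * g.1 z.
have ab (g : (Y -> R) * (Y -> R)) : hol W g.1 g.2 ->
    [/\ continuous (alpha g), continuous (beta g),
        supp_in 5 (alpha g) & supp_in 5 (beta g)].
  move=> hg; have C1 z : W z -> C1at g.1 z by move=> /hg[].
  have C2 z : W z -> C1at g.2 z by move=> /hg[].
  have [s1 c1] := prod _ _ (sdc e1) (C1dc e1) C1.
  have [s2 c2] := prod _ _ (sdc ei) (C1dc ei) C2.
  have [s3 c3] := prod _ _ (sdc e1) (C1dc e1) C2.
  have [s4 c4] := prod _ _ (sdc ei) (C1dc ei) C1.
  split.
  - by move=> z; exact: C1at_cts (C1atB (c1 z) (c2 z)).
  - by move=> z; exact: C1at_cts (C1atD (c3 z) (c4 z)).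
  - by move=> z zB; rewrite /alpha [X in X - _](s1 z zB) [X in _ - X](s2 z zB) subrr.
  - by move=> z zB; rewrite /beta [X in X + _](s3 z zB) [X in _ + X](s4 z zB) addr0.
have rep (g : (Y -> R) * (Y -> R)) : hol W g.1 g.2 ->
    cauchy e1 ei 5 (alpha g) (beta g) e1 = - (g.1 e1 * (pi *+ 2)).
  move=> hg; have C1 z : W z -> C1at g.1 z by move=> /hg[].
  have C2 z : W z -> C1at g.2 z by move=> /hg[].
  have [s1 c1] := prod _ _ schi C1c C1.
  have [s2 c2] := prod _ _ schi C1c C2.
  have e1n : `|e1| <= 2.
    apply/ltW/Cnorm_lt => // t; rewrite coordA_dirA coordB_dirA normr0; split=> //.
    by case: (_ == _); rewrite ?normr0 ?normr1 ?ltr1n.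
  have := cauchy_pompeiu (@circ_far_Cspace R 1 ord0) e1 c1 c2 s1.
  rewrite chi1 ?subr0 ?mulr1// mul1r => <-.
  apply: eq_cauchy => z; have [Wz|nW] := pselect (W z).
  - have [_ _ /(_ ord0)[r1 r2]] := hg z Wz.
    have d1 := C1at_diff (C1 z Wz); have d2 := C1at_diff (C2 z Wz).
    have dch := C1at_diff (C1c z).
    exact: esym (prod_re (deriveE_M e1 dch d1) (deriveE_M ei dch d2) r1).
  - have [h1 h2] := (near_derive e1 (out _ _ s1 nW), near_derive ei (out _ _ s2 nW)).
    rewrite h1.1 h2.1 !derive_cst subrr /alpha.
    rewrite (nbhs_singleton (out _ _ (sdc e1) nW)).
    by rewrite (nbhs_singleton (out _ _ (sdc ei) nW)) !mul0r subrr.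
  - have [_ _ /(_ ord0)[r1 r2]] := hg z Wz.
    have d1 := C1at_diff (C1 z Wz); have d2 := C1at_diff (C2 z Wz).
    have dch := C1at_diff (C1c z).
    exact: esym (prod_im (deriveE_M e1 dch d2) (deriveE_M ei dch d1) r2).
  - have [h1 h2] := (near_derive ei (out _ _ s1 nW), near_derive e1 (out _ _ s2 nW)).
    rewrite h1.1 h2.1 !derive_cst addr0 /beta.
    rewrite (nbhs_singleton (out _ _ (sdc e1) nW)).
    by rewrite (nbhs_singleton (out _ _ (sdc ei) nW)) !mul0r addr0.
have [ca cb sa sb] := ab (p, q) hpq.
have [Ca Ca0 CaP] := bounded_supp ca sa.
have [Cb Cb0 CbP] := bounded_supp cb sb.
pose C := Ca + Cb.
have C0 : 0 <= C by rewrite addr_ge0.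
(* The radius of integration of [cauchy] at [e1] for supports of size 5. The factor [pi *+ 2] in
   [cauchy_le] cancels against the one in the Cauchy formula. *)
pose rho : R := 2 * (`|5| + 1 + `|e1|).
have rho0 : 0 <= rho by rewrite mulr_ge0// !addr_ge0.
pose K := (C + C) * rho.
have bound m : `|p e1| <= K / 2 ^+ m.
  have [hg ge1 g0 gm] := @iter_divz W (p, q) m hpq pq0.
  set g := iter m divz (p, q) in hg ge1 g0 gm.
  have [cga cgb sga sgb] := ab g hg.
  have sq z : alpha g z ^+ 2 + beta g z ^+ 2 <= (C / 2 ^+ m) ^+ 2.
    have [z2|z2] := ltP `|z| 2.
      by rewrite /alpha /beta !dc0// !mul0r subrr addr0 expr0n /= addr0 sqr_ge0.
    have E (h : (Y -> R) * (Y -> R)) : alpha h z ^+ 2 + beta h z ^+ 2 =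
        ('D_e1 chi z ^+ 2 + 'D_ei chi z ^+ 2) * (h.1 z ^+ 2 + h.2 z ^+ 2).
      exact: norm_mul.
    rewrite E; apply: le_trans (ler_wpM2l _ (gm z z2)) _.
      by rewrite addr_ge0 ?sqr_ge0.
    rewrite mulrA -(E (p, q)) expr_div_n -exprM mulnC exprM (_ : 2 ^+ 2 = 4 :> R); last first.
      by rewrite -natrX.
    rewrite ler_wpM2r ?invr_ge0 ?exprn_ge0//.
    apply: (@le_trans _ _ (Ca ^+ 2 + Cb ^+ 2)).
      apply: lerD; rewrite -[X in X <= _]real_normK ?num_real//.
        by rewrite ler_pXn2r ?nnegrE.
      by rewrite ler_pXn2r ?nnegrE.
    by rewrite /C sqrrD lerD2r lerDl mulrn_wge0// mulr_ge0.
  have Cm0 : 0 <= C / 2 ^+ m by rewrite divr_ge0// exprn_ge0.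
  have le1 (x y : R) : x ^+ 2 + y ^+ 2 <= (C / 2 ^+ m) ^+ 2 -> `|x| <= C / 2 ^+ m.
    move=> xy; rewrite -(ler_pXn2r (n := 2))// ?nnegrE//.
    by rewrite real_normK ?num_real//; apply: le_trans xy; rewrite lerDl sqr_ge0.
  have la z : `|alpha g z| <= C / 2 ^+ m by exact: le1 (sq z).
  have lb z : `|beta g z| <= C / 2 ^+ m by apply: le1 (alpha g z) _; rewrite addrC; exact: sq.
  have := cauchy_le e1 ei 5 e1 cga cgb la lb.
  rewrite -/rho rep// ge1 normrN normrM.
  have pi2 : 0 < pi *+ 2 :> R by rewrite mulrn_wgt0// pi_gt0.
  rewrite (ger0_norm (ltW pi2)) mulrAC ler_pM2r//.
  by rewrite /K; move=> h; apply: (le_trans h); rewrite -mulrDl mulrAC.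
apply/eqP; rewrite -normr_le0 leNgt; apply/negP => p0.
have [m mP] : exists m : nat, K / `|p e1| < 2 ^+ m.
  exists (Num.bound (K / `|p e1|)).
  apply: lt_trans (archi_boundP _) _; first by rewrite divr_ge0// mulr_ge0// addr_ge0.
  by rewrite -natrX ltr_nat ltn_expl.
have := bound m; rewrite ler_pdivlMr ?exprn_gt0//.
by rewrite leNgt mulrC -ltr_pdivrMr// mP.
Qed.

Lemma identity_disc (W : set Y) p q : hol W p q ->
  (forall z, `|z| < 6 -> W z) ->
  (\forall z \near (0 : Y), p z = 0 /\ q z = 0) -> p e1 = 0 /\ q e1 = 0.
Proof.
move=> hpq W6 pq0; split; first exact: identity_disc_re hpq W6 pq0.
(* The imaginary part of p + i q is the real part of -i (p + i q) = q - i p. *)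
apply: (@identity_disc_re W q (fun z => - p z)) => //.
  move=> z Wz; have [Cp Cq CR] := hpq z Wz.
  split; [exact: Cq|exact: C1atN|move=> t].
  have dp : differentiable p z by exact: C1at_diff.
  have dN v : 'D_v (fun z => - p z) z = - 'D_v p z.
    by apply: deriveN; exact: diff_derivable.
  have [h1 h2] := CR t; split; first by rewrite [RHS]dN h2 opprK.
  by rewrite [X in _ = - X]dN h1 opprK.
by apply: filterS pq0 => z [h1 h2]; rewrite h1 oppr0.
Qed.

End Identity1.

(** * Identity theorem in several variables *)

Section IdentityTheorem.
Context {R : realType} {n : nat}.
Local Notation X := (Cspace R n).
Local Notation Y := (Cspace R 1).
Local Notation e1 := (dir_alpha R (ord0 : 'I_1)).
Local Notation ei := (dir_beta R (ord0 : 'I_1)).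

Definition imul (w : X) : X := (- w.2, w.1).

(** The complex number [l] times the vector [w], seen as a real linear map in [l]. *)
Definition line (w : X) (l : Y) : X := coordA ord0 l *: w + coordB ord0 l *: imul w.

Fact line_linear w : linear (line w).
Proof.
move=> k u v; rewrite /line [coordA _ _]linearP [coordB _ _]linearP /= !scalerDl scalerDr !scalerA.
by rewrite addrACA.
Qed.
HB.instance Definition _ w :=
  GRing.isLinear.Build R Y X _ (line w) (line_linear w).

Lemma cts_line w : continuous (line w).
Proof. by apply: ctsDv; apply: ctsZ; [exact: cts_coordA|exact: cts_coordB]. Qed.

Lemma line_e1 w : line w e1 = w.
Proof. by rewrite /line coordA_dirA coordB_dirA eqxx scale1r scale0r addr0. Qed.

Lemma line_ei w : line w ei = imul w.
Proof. by rewrite /line coordA_dirB coordB_dirB eqxx scale1r scale0r add0r. Qed.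

Lemma norm_imul w : `|imul w| = `|w|.
Proof. by rewrite !prod_normE /= normrN maxC. Qed.

Lemma norm_line w l : `|line w l| <= 2 * `|l| * `|w|.
Proof.
apply: le_trans (ler_normD _ _) _; rewrite !normrZ norm_imul -mulrDl ler_wpM2r//.
by have [h1 h2] := coord_le l ord0; rewrite mulrDl mul1r lerD.
Qed.

(** The Cauchy-Riemann equations in the coordinate directions make the differential of p + i q
    complex linear, which gives them in every direction. *)
Lemma hol_derive_imul (W : set X) (p q : X -> R) z w : hol W p q -> W z ->
  'D_w p z = 'D_(imul w) q z /\ 'D_(imul w) p z = - 'D_w q z.
Proof.
move=> hpq Wz; have [/C1at_diff dp /C1at_diff dq CR] := hpq z Wz.
have cA t : coordA t (imul w) = - coordB t w by rewrite /coordA /coordB /= mxE.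
have cB t : coordB t (imul w) = coordA t w by [].
rewrite !derive_Cspace//; split; last rewrite -sumrN; apply: eq_bigr => t _;
  have [r1 r2] := CR t; rewrite cA cB r1 r2; move: ('D_(_) q z) ('D_(_) q z) => a b; ring.
Qed.

Lemma hol_line (W : set X) (p q : X -> R) x w : hol W p q ->
  hol [set l | W (x + line w l)] (fun l => p (x + line w l)) (fun l => q (x + line w l)).
Proof.
move=> hpq l Wl; have [Cp Cq _] := hpq _ Wl.
have cL := @cts_line w.
split; [exact: (C1at_affine cL Cp)|exact: (C1at_affine cL Cq)|].
move=> t; rewrite (ord1 t).
have D f v : C1at f (x + line w l) ->
    'D_v (fun l => f (x + line w l)) l = 'D_(line w v) f (x + line w l).
  by move=> /C1at_diff df; exact: (derive_affine v cL df).2.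
have [r1 r2] := hol_derive_imul w hpq Wl.
have DA f : C1at f (x + line w l) ->
    'D_e1 (fun l => f (x + line w l)) l = 'D_w f (x + line w l).
  by move=> Cf; rewrite (D f e1 Cf) line_e1.
have DB f : C1at f (x + line w l) ->
    'D_ei (fun l => f (x + line w l)) l = 'D_(imul w) f (x + line w l).
  by move=> Cf; rewrite (D f ei Cf) line_ei.
split; first exact: etrans (DA p Cp) (etrans r1 (esym (DB q Cq))).
exact: etrans (DB p Cp) (etrans r2 (congr1 -%R (esym (DA q Cq)))).
Qed.

(** The disc lemma on the complex line through [x] and [x + w], read at l = 1. It needs the disc |l|
    < 6, and [norm_line] costs a factor 2, hence 12. *)
Lemma identity_ball (W : set X) (p q : X -> R) (x : X) : hol W p q ->
  (\forall z \near x, p z = 0 /\ q z = 0) ->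
  forall w : X, (forall y : X, `|y - x| < 12 * `|w| -> W y) -> p (x + w) = 0 /\ q (x + w) = 0.
Proof.
move=> hpq pq0 w Ww.
have [w0|w0] := eqVneq w 0.
  by rewrite w0 addr0; exact: nbhs_singleton pq0.
have := identity_disc (@hol_line W p q x w hpq); rewrite line_e1; apply.
  move=> l l6 /=; apply: Ww; rewrite addrC addKr; apply: le_lt_trans (norm_line _ _) _.
  by rewrite ltr_pM2r ?normr_gt0//; lra.
have c : x + line w l @[l --> (0 : Y)] --> x.
  rewrite -[X in _ --> X]addr0 -(linear0 (line w)).
  by apply: cvgD; [exact: cvg_cst|exact: cts_line].
exact: c _ pq0.
Qed.

Theorem identity (W V : set X) (p q : X -> R) : open W -> connected W -> hol W p q ->
  open V -> V !=set0 -> V `<=` W -> (forall z, V z -> p z = 0 /\ q z = 0) ->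
  forall z, W z -> p z = 0 /\ q z = 0.
Proof.
move=> oW cW hpq oV [v Vv] VW pq0.
(* This open set is closed in [W] because the reach of [identity_ball] is governed by the room left
   in [W], not by the size of the zero set. *)
pose S := [set z : X | \forall w \near z, p w = 0 /\ q w = 0].
have oS : open S by rewrite openE => z; exact: nbhs_interior.
suff E : W `&` S = W.
  by move=> z; rewrite -E => -[_ /nbhs_singleton].
apply: cW.
- exists v; split; first exact: VW.
  have : nbhs v V by exact: open_nbhs_nbhs.
  by apply: filterS => w; exact: pq0.
- by exists S.
exists (closure S); first exact: closed_closure.
apply/seteqP; split=> z [Wz Sz]; split=> //; first exact: subset_closure.
have /nbhs_ballP[r /= r0 rW] : nbhs z W by exact: open_nbhs_nbhs.
(* With [s] and [y] this close to [z], |y - s| < r / 13, and 12 r / 13 + r / 26 < r keeps the ball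
   about [s] inside [W]. *)
have r26 : 0 < r / 26 by rewrite divr_gt0.
have [s [Ss]] := Sz _ (nbhsx_ballx z _ r26); rewrite -ball_normE/= => zs.
apply/nbhs_ballP; exists (r / 26) => //= y; rewrite -ball_normE/= => zy.
have wE : `|y - s| < r / 13.
  have := ler_normD (y - z) (z - s); rewrite addrA subrK (distrC y z); lra.
have -> : y = s + (y - s) by rewrite addrC subrK.
apply: (identity_ball hpq Ss) => u hu; apply: rW; rewrite -ball_normE/=.
have := ler_normD (z - s) (s - u); rewrite addrA subrK (distrC s u).
move: hu wE; lra.
Qed.

End IdentityTheorem.

(** * Vector-valued holomorphic functions *)

Section PairDerive.
Context {R : realType} {X A B : normedModType R}.

Lemma derive_pair (f : X -> A) (g : X -> B) z v :
  derivable f z v -> derivable g z v ->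
  derivable (fun w => (f w, g w)) z v /\
  'D_v (fun w => (f w, g w)) z = ('D_v f z, 'D_v g z).
Proof.
move=> df dg.
have H : (fun h : R => h^-1 *: (((fun w => (f w, g w)) \o shift z) (h *: v) - (f z, g z)))
    @ 0^' --> ('D_v f z, 'D_v g z).
  have E : (fun h : R => h^-1 *: (((fun w => (f w, g w)) \o shift z) (h *: v) - (f z, g z)))
     = (fun h : R => (h^-1 *: ((f \o shift z) (h *: v) - f z),
                      h^-1 *: ((g \o shift z) (h *: v) - g z))) by [].
  by rewrite E; apply: cvg_pair; [exact: df|exact: dg].
by split; [apply/cvg_ex; exists ('D_v f z, 'D_v g z)|exact: cvg_lim H].
Qed.

Lemma derive_fst (F : X -> A * B) z v : derivable F z v ->
  derivable (fun w => (F w).1) z v /\ 'D_v (fun w => (F w).1) z = ('D_v F z).1.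
Proof.
move=> dF.
have H : (fun h : R => h^-1 *: (((fun w => (F w).1) \o shift z) (h *: v) - (F z).1))
    @ 0^' --> ('D_v F z).1.
  have := cvg_comp _ _ dF (@cvg_fst _ _ _ _ _); exact.
by split; [apply/cvg_ex; exists ('D_v F z).1|exact: cvg_lim H].
Qed.

Lemma derive_snd (F : X -> A * B) z v : derivable F z v ->
  derivable (fun w => (F w).2) z v /\ 'D_v (fun w => (F w).2) z = ('D_v F z).2.
Proof.
move=> dF.
have H : (fun h : R => h^-1 *: (((fun w => (F w).2) \o shift z) (h *: v) - (F z).2))
    @ 0^' --> ('D_v F z).2.
  have := cvg_comp _ _ dF (@cvg_snd _ _ _ _ _); exact.
by split; [apply/cvg_ex; exists ('D_v F z).2|exact: cvg_lim H].
Qed.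

End PairDerive.

Section Vector.
Context {R : realType} {n : nat}.
Local Notation X := (Cspace R n).
Local Notation eA := (dir_alpha R).
Local Notation eB := (dir_beta R).
Implicit Types (A B : normedModType R).

(** The clauses of [C1_on] with values in any normed space, so that an octonion-valued function can
    be split into nested pairs down to real functions. *)
Definition C1v A (W : set X) (F : X -> A) := forall t v, v = eA t \/ v = eB t ->
  forall z, W z -> derivable F z v /\ {for z, continuous (fun w => 'D_v F w)}.

Definition holv A (W : set X) (F1 F2 : X -> A) :=
  [/\ C1v W F1, C1v W F2 &
   forall t z, W z -> 'D_(eA t) F1 z = 'D_(eB t) F2 z /\
                      'D_(eB t) F1 z = - 'D_(eA t) F2 z].

Lemma C1v_pair A B (W : set X) (f : X -> A) (g : X -> B) : open W ->
  C1v W f -> C1v W g -> C1v W (fun w => (f w, g w)).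
Proof.
move=> oW Cf Cg t v tv z Wz.
have [df cf] := Cf t v tv z Wz; have [dg cg] := Cg t v tv z Wz.
have [d _] := derive_pair df dg; split=> //.
have E : \forall w \near z, ('D_v f w, 'D_v g w) = 'D_v (fun w => (f w, g w)) w.
  have : \forall w \near z, W w by exact: open_nbhs_nbhs.
  apply: filterS => w Ww; have [df' _] := Cf t v tv w Ww; have [dg' _] := Cg t v tv w Ww.
  by rewrite (derive_pair df' dg').2.
rewrite /prop_for /continuous_at -(nbhs_singleton E).
apply: cvg_trans (cvg_pair cf cg); exact: near_eq_cvg.
Qed.

Lemma C1v_fst A B (W : set X) (F : X -> A * B) : open W ->
  C1v W F -> C1v W (fun w => (F w).1) /\ C1v W (fun w => (F w).2).
Proof.
move=> oW CF; split=> t v tv z Wz; have [dF cF] := CF t v tv z Wz.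
  split; first exact: (derive_fst dF).1.
  have E : \forall w \near z, ('D_v F w).1 = 'D_v (fun w => (F w).1) w.
    have : \forall w \near z, W w by exact: open_nbhs_nbhs.
    by apply: filterS => w Ww; have [dF' _] := CF t v tv w Ww; rewrite (derive_fst dF').2.
  rewrite /prop_for /continuous_at -(nbhs_singleton E).
  by apply: cvg_trans (cvg_comp _ _ cF (@cvg_fst _ _ _ _ _)); exact: near_eq_cvg.
split; first exact: (derive_snd dF).1.
have E : \forall w \near z, ('D_v F w).2 = 'D_v (fun w => (F w).2) w.
  have : \forall w \near z, W w by exact: open_nbhs_nbhs.
  by apply: filterS => w Ww; have [dF' _] := CF t v tv w Ww; rewrite (derive_snd dF').2.
rewrite /prop_for /continuous_at -(nbhs_singleton E).
by apply: cvg_trans (cvg_comp _ _ cF (@cvg_snd _ _ _ _ _)); exact: near_eq_cvg.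
Qed.

Lemma holv_pair A B (W : set X) (f1 f2 : X -> A) (g1 g2 : X -> B) : open W ->
  holv W f1 f2 -> holv W g1 g2 ->
  holv W (fun w => (f1 w, g1 w)) (fun w => (f2 w, g2 w)).
Proof.
move=> oW [Cf1 Cf2 CRf] [Cg1 Cg2 CRg]; split; [exact: C1v_pair|exact: C1v_pair|].
move=> t z Wz; have [r1 r2] := CRf t z Wz; have [s1 s2] := CRg t z Wz.
have D (f : X -> A) (g : X -> B) v : (v = eA t \/ v = eB t) -> C1v W f -> C1v W g ->
    'D_v (fun w => (f w, g w)) z = ('D_v f z, 'D_v g z).
  by move=> tv /(_ t v tv z Wz)[df _] /(_ t v tv z Wz)[dg _]; exact: (derive_pair df dg).2.
rewrite !D//; try by [left|right].
by rewrite r1 r2 s1 s2.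
Qed.

Lemma holv_proj A B (W : set X) (F1 F2 : X -> A * B) : open W -> holv W F1 F2 ->
  holv W (fun w => (F1 w).1) (fun w => (F2 w).1) /\
  holv W (fun w => (F1 w).2) (fun w => (F2 w).2).
Proof.
move=> oW [C1 C2 CR]; have [a1 b1] := C1v_fst oW C1; have [a2 b2] := C1v_fst oW C2.
by split; split=> // t z Wz; have [r1 r2] := CR t z Wz;
  have [dA1 _] := C1 t (eA t) (or_introl erefl) z Wz;
  have [dB1 _] := C1 t (eB t) (or_intror erefl) z Wz;
  have [dA2 _] := C2 t (eA t) (or_introl erefl) z Wz;
  have [dB2 _] := C2 t (eB t) (or_intror erefl) z Wz;
  rewrite ?(derive_fst dA1).2 ?(derive_fst dB1).2 ?(derive_fst dA2).2 ?(derive_fst dB2).2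
    ?(derive_snd dA1).2 ?(derive_snd dB1).2 ?(derive_snd dA2).2 ?(derive_snd dB2).2 r1 r2.
Qed.

Lemma holv_hol (W : set X) (p q : X -> R^o) : open W -> holv W p q -> hol W p q.
Proof.
move=> oW [Cp Cq CR] z Wz; split.
- exact: (Cspace_C1at oW Cp).
- exact: (Cspace_C1at oW Cq).
- by move=> t; exact: CR.
Qed.

Lemma hol_holv (W : set X) (p q : X -> R^o) : hol W p q -> holv W p q.
Proof.
move=> hpq; split=> [t v _ z /hpq[Cp Cq CR]|t v _ z /hpq[Cp Cq CR]|t z /hpq[Cp Cq CR]].
- by split; [exact: diff_derivable (C1at_diff Cp)|exact: Cp.2].
- by split; [exact: diff_derivable (C1at_diff Cq)|exact: Cq.2].
- exact: CR.
Qed.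

(** Phrased as a property of the space of values that is stable under products: three doublings lead
    from the reals to the octonions, with the region of agreement [V] common to all components. *)
Definition extendable A (W E V : set X) := forall F1 F2 : X -> A, holv W F1 F2 ->
  exists G1 G2, holv E G1 G2 /\ forall z, V z -> G1 z = F1 z /\ G2 z = F2 z.

Lemma extendable_pair A B (W E V : set X) : open W -> open E ->
  extendable A W E V -> extendable B W E V -> extendable (A * B)%type W E V.
Proof.
move=> oW oE extA extB F1 F2 /(holv_proj oW)[/extA[G1 [G2 [hG GF]]] /extB[H1 [H2 [hH HF]]]].
exists (fun w => (G1 w, H1 w)), (fun w => (G2 w, H2 w)).
split; first exact: holv_pair.
move=> z Vz; have [-> ->] := GF z Vz; have [-> ->] := HF z Vz.
by rewrite -!surjective_pairing.
Qed.

Lemma extendable_oct (W E V : set X) : open W -> open E ->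
  extendable R^o W E V -> extendable (oct R) W E V.
Proof.
by move=> oW oE e; do 3!(apply: extendable_pair => //).
Qed.

Definition determined A (W V : set X) := forall F1 F2 G1 G2 : X -> A,
  holv W F1 F2 -> holv W G1 G2 ->
  (forall z, V z -> F1 z = G1 z /\ F2 z = G2 z) ->
  forall z, W z -> F1 z = G1 z /\ F2 z = G2 z.

Lemma determined_pair A B (W V : set X) : open W ->
  determined A W V -> determined B W V -> determined (A * B)%type W V.
Proof.
move=> oW dA dB F1 F2 G1 G2 /(holv_proj oW)[Fa Fb] /(holv_proj oW)[Ga Gb] FG z Wz.
have [a1 a2] := dA _ _ _ _ Fa Ga (fun z Vz =>
  conj (congr1 fst (FG z Vz).1) (congr1 fst (FG z Vz).2)) z Wz.
have [b1 b2] := dB _ _ _ _ Fb Gb (fun z Vz =>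
  conj (congr1 snd (FG z Vz).1) (congr1 snd (FG z Vz).2)) z Wz.
by rewrite [F1 z]surjective_pairing [F2 z]surjective_pairing a1 a2 b1 b2 -!surjective_pairing.
Qed.

Lemma determined_oct (W V : set X) : open W -> connected W -> open V -> V !=set0 ->
  V `<=` W -> determined (oct R) W V.
Proof.
move=> oW cW oV V0 VW.
have d0 : determined R^o W V.
  move=> F1 F2 G1 G2 hF hG FG z Wz.
  have hd : hol W (fun z => F1 z - G1 z) (fun z => F2 z - G2 z).
    move=> w Ww; have [C1 C2 CR] := holv_hol oW hF Ww.
    have [C1' C2' CR'] := holv_hol oW hG Ww.
    split; [exact: C1atB|exact: C1atB|] => t.
    have [r1 r2] := CR t; have [s1 s2] := CR' t.
    have D (f g : X -> R) v : C1at f w -> C1at g w ->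
        'D_v (fun z => f z - g z) w = 'D_v f w - 'D_v g w.
      by move=> /C1at_diff df /C1at_diff dg; rewrite deriveE_B.
    split; first by rewrite (D _ _ _ C1 C1') (D _ _ _ C2 C2') r1 s1.
    by rewrite (D _ _ _ C1 C1') (D _ _ _ C2 C2') r2 s2 opprB opprK addrC.
  have [] := identity oW cW hd oV V0 VW _ Wz.
    by move=> y /FG[-> ->]; rewrite !subrr.
  by move=> /eqP + /eqP; rewrite !subr_eq0 => /eqP -> /eqP ->.
by do 3!(apply: determined_pair => //).
Qed.

End Vector.

(** * Slice functions *)

Section Octonions.
Context {R : realType}.
Implicit Types (x y J : oct R) (k : R).

Lemma oct_eq (a b c d e f g h a' b' c' d' e' f' g' h' : R) :
  a = a' -> b = b' -> c = c' -> d = d' -> e = e' -> f = f' -> g = g' -> h = h' ->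
  ((((a, b), (c, d)), ((e, f), (g, h))) : oct R) = (((a', b'), (c', d')), ((e', f'), (g', h'))).
Proof. by move=> -> -> -> -> -> -> -> ->. Qed.

Lemma oct_mul_scale k x y : oct_mul (k *: x) (k *: y) = (k * k) *: oct_mul x y.
Proof.
move: x y => [[[a b] [c d]] [[e f] [g h]]] [[[a' b'] [c' d']] [[e' f'] [g' h']]].
have sE (c0 : R) (u : R^o) : c0 *: u = c0 * u by [].
by apply: oct_eq; rewrite /GRing.scale/= !sE; ring.
Qed.

Lemma oct_mul1l x : oct_mul (oct_one R) x = x.
Proof.
move: x => [[[a b] [c d]] [[e f] [g h]]].
by apply: oct_eq => /=; ring.
Qed.

Lemma oct_mul0l x : oct_mul 0 x = 0.
Proof.
move: x => [[[a b] [c d]] [[e f] [g h]]].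
by apply: oct_eq => /=; ring.
Qed.

Lemma oct_mul0r x : oct_mul x 0 = 0.
Proof.
move: x => [[[a b] [c d]] [[e f] [g h]]].
by apply: oct_eq => /=; ring.
Qed.

Lemma oct_mulNN x y : oct_mul (- x) (- y) = oct_mul x y.
Proof. by rewrite -scaleN1r -(scaleN1r y) oct_mul_scale mulrNN mulr1 scale1r. Qed.

(** If the real part a were nonzero, the vanishing imaginary components 2 a b, 2 a c, ... of the
    square would make [J] real, and a^2 = -1 is impossible. *)
Lemma oct_sphere_re J : oct_sphere J -> J.1.1.1 = 0.
Proof.
move: J => [[[a b] [c d]] [[e f] [g h]]]; rewrite /oct_sphere /=.
rewrite /oct_mul /cd_mul /cd2_mul /cd_mul /cd1_mul /cd_mul /=.
case=> h0 h1 h2 h3 h4 h5 h6 h7.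
apply/eqP/negP => /negP a0.
have z (x : R) : a * x = 0 -> x = 0.
  by move=> /eqP; rewrite mulf_eq0 (negbTE a0) => /eqP.
have b0 : b = 0 by apply: z; lra.
have c0 : c = 0 by apply: z; lra.
have d0 : d = 0 by apply: z; lra.
have e0 : e = 0 by apply: z; lra.
have f0 : f = 0 by apply: z; lra.
have g0 : g = 0 by apply: z; lra.
have hh0 : h = 0 by apply: z; lra.
have := sqr_ge0 a; move: h0; rewrite b0 c0 d0 e0 f0 g0 hh0; lra.
Qed.

Lemma oct_one_neq0 : oct_one R != 0.
Proof. by apply/eqP => -[] /eqP; rewrite oner_eq0. Qed.

Lemma oct_sphere_neq0 J : oct_sphere J -> J != 0.
Proof.
move=> SJ; apply/eqP => J0; move: SJ; rewrite /oct_sphere/= J0 oct_mul0l.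
by move=> /esym/eqP; rewrite oppr_eq0; apply/negP; exact: oct_one_neq0.
Qed.

Lemma oct_sphere_scale k J J' : oct_sphere J -> oct_sphere J' -> J = k *: J' ->
  k = 1 \/ k = -1.
Proof.
rewrite /oct_sphere/= => SJ SJ' E; move: SJ; rewrite E oct_mul_scale SJ' => /eqP.
rewrite scalerN eqr_opp -subr_eq0 -[X in _ - X]scale1r -scalerBl scaler_eq0.
rewrite (negbTE oct_one_neq0) orbF subr_eq0 -expr2 sqrf_eq1.
by move=> /orP[] /eqP ->; [left|right].
Qed.

Lemma octC_mul_i (w : octC R) : octC_mul (octC_i R) w = (- w.2, w.1).
Proof. by rewrite /octC_mul /= !oct_mul0l !oct_mul1l sub0r add0r. Qed.

End Octonions.

Lemma half_eq0 (R : realType) (V : lmodType R) (v : V) : 2^-1 *: v = 0 -> v = 0.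
Proof. by move=> /eqP; rewrite scaler_eq0 invr_eq0 pnatr_eq0 => /eqP. Qed.

Lemma self_opp_eq0 (R : realType) (V : lmodType R) (v : V) : v = - v -> v = 0.
Proof.
move=> E; have /eqP : (2 : R) *: v = 0 by rewrite scaler_nat mulr2n [X in _ + X]E subrr.
by rewrite scaler_eq0 pnatr_eq0 => /eqP.
Qed.

Section Slice.
Context {R : realType} {n : nat}.
Local Notation X := (Cspace R n).

(** Units have real part 0, so real parts give alpha. Then beta J = beta' J': either beta = 0, or
    the units are proportional, by a factor 1 or -1 since both square to -1. *)
Lemma slice_point_inj (J J' : oct R) (z z' : X) : oct_sphere J -> oct_sphere J' ->
  slice_point J z = slice_point J' z' ->
  [\/ z' = z /\ z.2 = 0, J' = J /\ z' = z | J' = - J /\ z' = Cspace_conj z].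
Proof.
move=> SJ SJ' E.
have Et t : z.1 0 t *: oct_one R + z.2 0 t *: J = z'.1 0 t *: oct_one R + z'.2 0 t *: J'.
  by have := congr1 (fun x : 'rV[oct R]_n => x 0 t) E; rewrite !mxE.
have E1 : z'.1 = z.1.
  apply/rowP => t; have := congr1 (fun x : oct R => x.1.1.1) (Et t).
  rewrite /= /GRing.scale/= (oct_sphere_re SJ) (oct_sphere_re SJ').
  by rewrite !mulr0 !mulr1 !addr0.
have E2 t : z.2 0 t *: J = z'.2 0 t *: J' by have := Et t; rewrite E1 => /addrI.
have J0 := oct_sphere_neq0 SJ; have J0' := oct_sphere_neq0 SJ'.
have [z0|] := eqVneq z.2 0.
  apply: Or31; split=> //; rewrite [z]surjective_pairing [z']surjective_pairing E1 z0.
  congr (_, _); apply/rowP => t; rewrite mxE; have /esym/eqP := E2 t.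
  by rewrite z0 mxE scale0r scaler_eq0 (negbTE J0') orbF => /eqP.
move=> /eqP/rowP/existsNP[t]; rewrite mxE => /eqP t0.
have JE : J = (z'.2 0 t / z.2 0 t) *: J'.
  by rewrite mulrC -scalerA -E2 scalerA mulVf// scale1r.
have [k1|k1] := oct_sphere_scale SJ SJ' JE; rewrite k1 ?scale1r ?scaleN1r in JE.
  apply: Or32; split=> //; rewrite [z]surjective_pairing [z']surjective_pairing E1.
  congr (_, _); apply/rowP => s; have /eqP := E2 s.
  by rewrite JE -subr_eq0 -scalerBl scaler_eq0 (negbTE J0') orbF subr_eq0 => /eqP.
apply: Or33; split; first by rewrite JE opprK.
rewrite [z']surjective_pairing /Cspace_conj E1.
congr (_, _); apply/rowP => s; rewrite mxE; have /eqP := E2 s.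
rewrite JE scalerN -scaleNr -subr_eq0 -scalerBl scaler_eq0 (negbTE J0') orbF subr_eq0.
by move=> /eqP.
Qed.

(** Well-definedness of I(F). At a real point the unit is arbitrary, but the stem condition at z =
    conj z forces [(F z).2 = 0]; for conjugate points the sign changes of the unit and of F_2
    cancel. *)
Lemma slice_value (D : set X) (F : X -> octC R) (J J' : oct R) (z z' : X) : stem D F ->
  D z -> D z' -> oct_sphere J -> oct_sphere J' ->
  slice_point J z = slice_point J' z' ->
  (F z).1 + oct_mul J (F z).2 = (F z').1 + oct_mul J' (F z').2.
Proof.
move=> sF Dz Dz' SJ SJ' /(slice_point_inj SJ SJ')[[E z0]|[-> ->]//|[-> E]].
  have cz : Cspace_conj z = z.
    by rewrite /Cspace_conj z0 oppr0 -z0 -surjective_pairing.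
  have := sF z Dz; rewrite cz => /(_ Dz) FE.
  have F0 : (F z).2 = 0 by apply: self_opp_eq0; rewrite {1}FE.
  by rewrite E F0 !oct_mul0r.
by rewrite E (sF z Dz) -?E//= oct_mulNN.
Qed.

Lemma slice_exists (D : set X) (F : X -> octC R) : stem D F ->
  exists g : 'rV[oct R]_n -> oct R, slice_induced D F g.
Proof.
move=> sF.
have H (x : 'rV[oct R]_n) : exists y, forall J z, oct_sphere J -> D z ->
    x = slice_point J z -> y = (F z).1 + oct_mul J (F z).2.
  have [[J [z [SJ Dz xE]]]|no] := pselect (Omega D x).
    exists ((F z).1 + oct_mul J (F z).2) => J' z' SJ' Dz' xE'.
    by apply: slice_value sF Dz Dz' SJ SJ' _; rewrite -xE -xE'.
  by exists 0 => J z SJ Dz xE; case: no; exists J, z.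
have /choice[g gP] := H.
by exists g => J z SJ Dz; exact: gP.
Qed.

(** Left multiplication by i sends (x, y) to (- y, x), so the dbar equation becomes a Cauchy-Riemann
    system. *)
Lemma dbar_eq0 (w v : octC R) :
  2^-1 *: (w + octC_mul (octC_i R) v) = 0 <-> w.1 = v.2 /\ v.1 = - w.2.
Proof.
rewrite octC_mul_i; split=> [/half_eq0 E|[E1 E2]].
  split; first by apply: subr0_eq; exact: (congr1 (fun x : octC R => x.1) E).
  by apply/esym/addr0_eq; exact: (congr1 (fun x : octC R => x.2) E).
have -> : w + (- v.2, v.1) = 0; last exact: scaler0.
by rewrite [w]surjective_pairing; congr (_, _); rewrite /= ?E1 ?E2 subrr.
Qed.

Lemma holomorphic_onP (D : set X) (F : X -> octC R) : open D ->
  holomorphic_on D F <-> holv D (fun z => (F z).1) (fun z => (F z).2).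
Proof.
move=> oD; split=> [[CF dF]|[C1 C2 CR]].
  have [C1 C2] := C1v_fst oD CF.
  split; [exact: C1|exact: C2|move=> t z Dz].
  have [dA _] := CF t _ (or_introl erefl) z Dz.
  have [dB _] := CF t _ (or_intror erefl) z Dz.
  have [H1 H2] := (dbar_eq0 _ _).1 (dF t z Dz); split.
    exact: etrans (derive_fst dA).2 (etrans H1 (esym (derive_snd dB).2)).
  exact: etrans (derive_fst dB).2 (etrans H2 (congr1 -%R (esym (derive_snd dA).2))).
have E : F = fun z => ((F z).1, (F z).2).
  by apply/funext => z; exact: surjective_pairing.
have CF : C1v D F by rewrite E; exact: C1v_pair.
split; first exact: CF.
move=> t z Dz; apply: (dbar_eq0 _ _).2.
have [dA _] := CF t _ (or_introl erefl) z Dz.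
have [dB _] := CF t _ (or_intror erefl) z Dz.
have [H1 H2] := CR t z Dz; split.
  exact: etrans (esym (derive_fst dA).2) (etrans H1 (derive_snd dB).2).
exact: etrans (esym (derive_fst dB).2) (etrans H2 (congr1 -%R (derive_snd dA).2)).
Qed.

End Slice.

(** Needed because conjugation reverses the beta directions, while only derivability along these
    directions is known. *)
Lemma derive_oppdir (R : realType) (X A : normedModType R) (f : X -> A) (z v : X) :
  derivable f z v -> is_derive z (- v) f (- 'D_v f z).
Proof.
move=> df.
have H : (fun h : R => h^-1 *: ((f \o shift z) (h *: (- v)) - f z)) @ 0^' --> - 'D_v f z.
  have cN : (fun h : R => - h) @ (0 : R)^' --> (0 : R)^'.
    move=> P nP; have nP' : \forall h \near (0 : R), h != 0 -> P h by exact: nP.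
    suff : \forall h \near (0 : R), h != 0 -> P (- h) by [].
    have c : - h @[h --> (0 : R)] --> (0 : R).
      by rewrite -[X in _ --> X]oppr0; apply: cvgN; exact: cvg_id.
    have : \forall h \near (0 : R), - h != 0 -> P (- h) by exact: (c _ nP').
    by apply: filterS => h /= Ph h0; apply: Ph; rewrite oppr_eq0.
  pose q (h : R) := h^-1 *: ((f \o shift z) (h *: v) - f z).
  have E : (fun h : R => h^-1 *: ((f \o shift z) (h *: (- v)) - f z)) =
      (fun h : R => - q (- h)).
    by apply/funext => h; rewrite /q /= invrN scaleNr opprK scalerN scaleNr.
  by rewrite E; apply: cvgN; exact: (cvg_comp _ _ cN df).
by split; [apply/cvg_ex; exists (- 'D_v f z)|exact: cvg_lim H].
Qed.

(** * Conjugation *)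

Section Symmetry.
Context {R : realType} {n : nat}.
Local Notation X := (Cspace R n).
Local Notation eA := (dir_alpha R).
Local Notation eB := (dir_beta R).
Local Notation conj := (@Cspace_conj R n).
Implicit Types (A : normedModType R).

Lemma conjK : involutive conj.
Proof. by move=> [a b]; rewrite /Cspace_conj /= opprK. Qed.

Lemma cts_conj : continuous conj.
Proof.
apply: cts_pair; first exact: cts_fst.
by move=> z; apply: cvgN; exact: cts_snd.
Qed.

Lemma conj_shift (h : R) (v z : X) : conj (h *: v + z) = h *: conj v + conj z.
Proof. by congr (_, _); rewrite /= opprD scalerN. Qed.

Lemma conj_dirA t : conj (eA t) = eA t.
Proof. by rewrite /Cspace_conj /= oppr0. Qed.

Lemma conj_dirB t : conj (eB t) = - eB t.
Proof. by congr (_, _); rewrite /= oppr0. Qed.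

Lemma derive_conj A (f : X -> A) z v : derivable f (conj z) (conj v) ->
  is_derive z v (fun w => f (conj w)) ('D_(conj v) f (conj z)).
Proof.
move=> df.
have E : (fun h : R => h^-1 *: (((fun w => f (conj w)) \o shift z) (h *: v) - f (conj z))) =
         (fun h : R => h^-1 *: ((f \o shift (conj z)) (h *: conj v) - f (conj z))).
  by apply/funext => h /=; rewrite conj_shift.
by split; rewrite /derivable /derive E.
Qed.

(** Holomorphy is local, hence can be checked on a function given by different formulas on
    overlapping open sets. *)
Lemma holv_glue A (W : set X) (F1 F2 : X -> A) :
  (forall z, W z -> exists S H1 H2, [/\ open S, S z, holv S H1 H2 &
     forall w, S w -> F1 w = H1 w /\ F2 w = H2 w]) -> holv W F1 F2.
Proof.
move=> H.
have loc (F G : X -> A) (S : set X) z v : open S -> S z ->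
    (forall w, S w -> F w = G w) ->
    derivable G z v /\ {for z, continuous (fun w => 'D_v G w)} ->
    derivable F z v /\ {for z, continuous (fun w => 'D_v F w)}.
  move=> oS Sz FG [dG cG].
  have GF : \forall w \near z, G w = F w.
    have : nbhs z S by exact: open_nbhs_nbhs.
    by apply: filterS => w /FG.
  split; first exact: (near_derive v GF).2 dG.
  apply: near_cts cG; apply: filterS (nbhs_interior GF) => w Gw.
  exact: (near_derive v Gw).1.
split.
- move=> t v tv z Wz; have [S [H1 [H2 [oS Sz [C1 _ _] FH]]]] := H z Wz.
  by apply: (loc F1 H1 S) => // [w /FH[]//|]; exact: C1 tv z Sz.
- move=> t v tv z Wz; have [S [H1 [H2 [oS Sz [_ C2 _] FH]]]] := H z Wz.
  by apply: (loc F2 H2 S) => // [w /FH[]//|]; exact: C2 tv z Sz.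
move=> t z Wz; have [S [H1 [H2 [oS Sz [_ _ CR] FH]]]] := H z Wz.
have E1 : \forall w \near z, F1 w = H1 w.
  have : nbhs z S by exact: open_nbhs_nbhs.
  by apply: filterS => w /FH[].
have E2 : \forall w \near z, F2 w = H2 w.
  have : nbhs z S by exact: open_nbhs_nbhs.
  by apply: filterS => w /FH[].
have [r1 r2] := CR t z Sz; split.
  exact: etrans (near_derive _ E1).1 (etrans r1 (esym (near_derive _ E2).1)).
exact: etrans (near_derive _ E1).1 (etrans r2 (congr1 -%R (esym (near_derive _ E2).1))).
Qed.

Lemma derive_conjA A (S : set X) (F : X -> A) t z : C1v S F -> S (conj z) ->
  is_derive z (eA t) (fun z => F (conj z)) ('D_(eA t) F (conj z)).
Proof.
move=> CF Sz; have [dF _] := CF t _ (or_introl erefl) _ Sz.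
by rewrite -{2}(conj_dirA t); apply: derive_conj; rewrite conj_dirA; exact: dF.
Qed.

Lemma derive_conjB A (S : set X) (F : X -> A) t z : C1v S F -> S (conj z) ->
  is_derive z (eB t) (fun z => F (conj z)) (- 'D_(eB t) F (conj z)).
Proof.
move=> CF Sz; have [dF _] := CF t _ (or_intror erefl) _ Sz.
have [d1 d2] := derive_oppdir dF.
by rewrite -d2 -(conj_dirB t); apply: derive_conj; rewrite conj_dirB; exact: d1.
Qed.

Lemma open_conj (S : set X) : open S -> open [set z | S (conj z)].
Proof. by move=> oS; apply: open_comp => // ? _; exact: cts_conj. Qed.

Lemma C1v_conj A (S : set X) (F : X -> A) : open S -> C1v S F ->
  C1v [set z | S (conj z)] (fun z => F (conj z)).
Proof.
move=> oS CF t v tv z Sz.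
have nS : \forall w \near z, S (conj w).
  by apply: open_nbhs_nbhs; split=> //; exact: open_conj.
case: tv => ->.
  split; first by have [] := derive_conjA t CF Sz.
  have [_ cF] := CF t _ (or_introl erefl) _ Sz.
  apply: (@near_cts _ _ (fun w => 'D_(eA t) F (conj w))).
    apply: filterS nS => w Sw; have [_ E] := derive_conjA t CF Sw; exact: esym E.
  exact: (cvg_comp _ _ (@cts_conj z) cF).
split; first by have [] := derive_conjB t CF Sz.
have [_ cF] := CF t _ (or_intror erefl) _ Sz.
apply: (@near_cts _ _ (fun w => - 'D_(eB t) F (conj w))).
  apply: filterS nS => w Sw; have [_ E] := derive_conjB t CF Sw; exact: esym E.
by apply: cvgN; exact: (cvg_comp _ _ (@cts_conj z) cF).
Qed.

Lemma C1vN A (S : set X) (F : X -> A) : open S -> C1v S F -> C1v S (fun z => - F z).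
Proof.
move=> oS CF t v tv z Sz; have [dF cF] := CF t v tv z Sz.
split; first exact: derivableN.
have nS : \forall w \near z, S w by exact: open_nbhs_nbhs.
apply: (@near_cts _ _ (fun w => - 'D_v F w)); last by apply: cvgN; exact: cF.
by apply: filterS nS => w Sw; have [dF' _] := CF t v tv w Sw; exact: esym (deriveN dF').
Qed.

(** Conjugating the argument reverses the beta derivatives and conjugating the value reverses [F2];
    both sides of each Cauchy-Riemann equation keep matching signs. *)
Lemma holv_conj A (S : set X) (F1 F2 : X -> A) : open S -> holv S F1 F2 ->
  holv [set z | S (conj z)] (fun z => F1 (conj z)) (fun z => - F2 (conj z)).
Proof.
move=> oS [C1 C2 CR].
have C1' := C1v_conj oS C1; have C2' := C1v_conj oS C2.
split; [exact: C1'|exact: C1vN (open_conj oS) C2'|move=> t z Sz].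
have [r1 r2] := CR t _ Sz.
have [_ a1] := derive_conjA t C1 Sz; have [_ b1] := derive_conjB t C1 Sz.
have [d2 a2] := derive_conjA t C2 Sz; have [e2 b2] := derive_conjB t C2 Sz.
have a2' := deriveN d2; have b2' := deriveN e2; split.
  by apply: (etrans a1); apply/esym; apply: (etrans b2'); rewrite b2 opprK r1.
by apply: (etrans b1); apply/esym; rewrite [X in - X]a2' a2 opprK r2 opprK.
Qed.

Lemma C1vD A (k : R) (S : set X) (F H : X -> A) : open S -> C1v S F -> C1v S H ->
  C1v S (fun z => k *: (F z + H z)) /\
  forall t v z, v = eA t \/ v = eB t -> S z ->
    'D_v (fun z => k *: (F z + H z)) z = k *: ('D_v F z + 'D_v H z).
Proof.
move=> oS CF CH.
have D t v z : v = eA t \/ v = eB t -> S z ->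
    is_derive z v (fun z => k *: (F z + H z)) (k *: ('D_v F z + 'D_v H z)).
  move=> tv Sz; have [dF _] := CF t v tv z Sz; have [dH _] := CH t v tv z Sz.
  by apply: is_deriveZ; apply: is_deriveD; exact: derivableP.
split=> [t v tv z Sz|t v z tv Sz]; last by have [] := D t v z tv Sz.
split; first by have [] := D t v z tv Sz.
have nS : \forall w \near z, S w by exact: open_nbhs_nbhs.
apply: (@near_cts _ _ (fun w => k *: ('D_v F w + 'D_v H w))).
  by apply: filterS nS => w Sw; have [_ E] := D t v w tv Sw; exact: esym E.
have [_ cF] := CF t v tv z Sz; have [_ cH] := CH t v tv z Sz.
by apply: cvgZr; apply: cvgD; [exact: cF|exact: cH].
Qed.

Lemma holvD A (k : R) (S : set X) (F1 F2 H1 H2 : X -> A) : open S ->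
  holv S F1 F2 -> holv S H1 H2 ->
  holv S (fun z => k *: (F1 z + H1 z)) (fun z => k *: (F2 z + H2 z)).
Proof.
move=> oS [CF1 CF2 CRF] [CH1 CH2 CRH].
have [C1 D1] := C1vD k oS CF1 CH1; have [C2 D2] := C1vD k oS CF2 CH2.
split; [exact: C1|exact: C2|move=> t z Sz].
have [r1 r2] := CRF t z Sz; have [s1 s2] := CRH t z Sz.
have a1 := D1 t _ z (or_introl erefl) Sz; have b1 := D1 t _ z (or_intror erefl) Sz.
have a2 := D2 t _ z (or_introl erefl) Sz; have b2 := D2 t _ z (or_intror erefl) Sz.
split.
  exact: etrans a1 (etrans (congr1 (fun x => k *: x) (congr2 +%R r1 s1)) (esym b2)).
by apply: (etrans b1); apply/esym; rewrite [X in - X]a2 r2 s2 -opprD scalerN.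
Qed.

End Symmetry.

(** * Hartogs extension of stem functions *)

Section Hartogs.
Context {R : realType} {n : nat}.
Local Notation X := (Cspace R n).
Local Notation conj := (@Cspace_conj R n).

(* [V] lies beyond the support of the cutoff in a real direction transverse to
   the complex direction of integration, so the extension agrees with [F]
   there. *)
Lemma hartogs_symmetric (n_ge2 : (2 <= n)%N) (D K : set X) (F : X -> octC R) :
  open D -> compact K -> K `<=` D -> K !=set0 -> stem (D `\` K) F ->
  holv (D `\` K) (fun z => (F z).1) (fun z => (F z).2) ->
  exists2 G : X -> octC R,
    stem D G /\ holv D (fun z => (G z).1) (fun z => (G z).2) &
    exists V : set X, [/\ open V, V !=set0, V `<=` D `\` K &
      forall z, V z -> G z = F z].
Proof.
move=> oD cK KD K0 sF hF.
have clK : closed K by apply: compact_closed => //; exact: norm_hausdorff.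
have oDK : open (D `\` K) by rewrite setDE; apply: openI => //; exact: closed_openC.
pose t1 : 'I_n := Ordinal (leq_trans (ltnSn 0) (ltnW n_ge2)).
pose t2 : 'I_n := Ordinal n_ge2.
have t12 : t1 != t2 by [].
pose cs (S : set X) := [set z | S (conj z)].
pose E := D `|` cs D; pose W := (D `\` K) `|` cs (D `\` K).
have oE : open E by apply: openU => //; exact: open_conj.
have oW : open W by apply: openU => //; exact: open_conj.
have cKc : compact (K `|` cs K).
  apply: compactU => //.
  have -> : cs K = conj @` K.
    apply/seteqP; split=> [z Kz|z [w Kw <-]]; last by rewrite /cs/= conjK.
    by exists (conj z) => //; exact: conjK.
  by apply: continuous_compact => //; apply: continuous_subspaceT; exact: cts_conj.
have KcE : K `|` cs K `<=` E by move=> z [/KD|/KD]; [left|right].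
have Kc0 : (K `|` cs K) !=set0 by have [k Kk] := K0; exists k; left.
have [chi [M [B [Cchi chi1 chi0 [chiB chiM] [p0 Ep0 Mp0]]]]] :=
  cutoff t2 cKc oE KcE Kc0.
(* A point of [E] outside [W] lies in [K] or in its conjugate. *)
have chi1' z : E z -> ~ W z -> \forall w \near z, chi w = 1.
  move=> Ez nW; apply: chi1; case: Ez => Dz.
    by left; apply: contrapT => nK; apply: nW; left.
  by right; apply: contrapT => nK; apply: nW; right.
have ext : extendable R^o W E [set z | M < coordA t2 z].
  move=> p q hpq.
  have [G1 [G2 [hG GF]]] := scalar_extension t12 (holv_hol oW hpq) Cchi chi1' chi0 chiB chiM.
  by exists G1, G2; split => //; exact: hol_holv.
(* On the overlap the two formulas agree by the stem condition; this is what [FtC] records. *)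
pose Ft z : octC R := if pselect ((D `\` K) z) then F z else octC_conj (F (conj z)).
have FtE z : (D `\` K) z -> Ft z = F z by rewrite /Ft; case: pselect.
have FtC z : (D `\` K) (conj z) -> Ft z = octC_conj (F (conj z)).
  move=> Wz; rewrite /Ft; case: pselect => // Dz.
  by rewrite (sF z Dz Wz) /octC_conj /= opprK -surjective_pairing.
have hFt : holv W (fun z => (Ft z).1) (fun z => (Ft z).2).
  apply: holv_glue => z [Wz|Wz].
    exists (D `\` K), (fun z => (F z).1), (fun z => (F z).2); split=> // w Dw.
    by rewrite FtE.
  exists (cs (D `\` K)), (fun z => (F (conj z)).1), (fun z => - (F (conj z)).2).
    split; [exact: open_conj oDK|exact: Wz|exact: holv_conj oDK hF|].
    by move=> w Dw; rewrite FtC.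
have [G1 [G2 [hG GF]]] := extendable_oct oW oE ext hFt.
have hG' : holv E (fun z => G1 (conj z)) (fun z => - G2 (conj z)).
  have -> : E = cs E.
    apply/seteqP; split=> z [|]; rewrite /E/cs/=; try by [right|left].
    - by move=> Dz; right; rewrite /cs /= conjK.
    - by rewrite conjK; left.
  exact: holv_conj oE hG.
have hS := holvD 2^-1 oE hG hG'.
pose S z : octC R := (2^-1 *: (G1 z + G1 (conj z)), 2^-1 *: (G2 z - G2 (conj z))).
exists S.
  split=> [z _ _|].
    have e1 : 2^-1 *: (G1 (conj z) + G1 (conj (conj z))) = 2^-1 *: (G1 z + G1 (conj z)).
      by rewrite conjK addrC.
    have e2 : 2^-1 *: (G2 (conj z) - G2 (conj (conj z))) = - (2^-1 *: (G2 z - G2 (conj z))).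
      by rewrite conjK -scalerN opprB.
    by apply: injective_projections; [exact: e1|exact: e2].
  have [C1 C2 CR] := hS.
  have DE z : D z -> E z by left.
  by split=> [t v tv z /DE|t v tv z /DE|t z /DE];
    [exact: C1 tv z|exact: C2 tv z|exact: CR].
pose V := [set z | M < coordA t2 z] `&` (D `\` K).
(* Conjugation keeps the real part, so both points in the average lie beyond [M], where the
   extension is [Ft]. *)
have VM z : V z -> M < coordA t2 (conj z) by case.
exists V; split.
- apply: openI => //; apply: (open_comp (D := [set x | M < x])) => [z _|].
    exact: cts_coordA.
  exact: open_gt.
(* If the point supplied by [cutoff] lies only in the conjugate of [D], its conjugate is in [D] with
   the same real part. It is not in [K], where the cutoff is 1, since the cutoff is 0 beyond [M]. *)
- have [p Dp Mp] : exists2 p, D p & M < coordA t2 p.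
    by case: Ep0 => Dp; [exists p0|exists (conj p0)].
  exists p; split=> //; split=> // Kp.
  have := nbhs_singleton (chi1 p (or_introl Kp)); rewrite chiM//.
  by move=> /esym/eqP; rewrite oner_eq0.
- by move=> z [].
move=> z [Mz Dz].
have Fc : Ft (conj z) = octC_conj (F z).
  by rewrite -[in RHS](conjK z); apply: FtC; rewrite conjK.
have [g1 g2] := GF z Mz; have [h1 h2] := GF (conj z) Mz.
have half (v : oct R) : 2^-1 *: (v + v) = v.
  by rewrite scalerDr -scalerDl (_ : 2^-1 + 2^-1 = 1) ?scale1r//; field.
by rewrite /S g1 g2 h1 h2 Fc (FtE z Dz) /= opprK !half -surjective_pairing.
Qed.

End Hartogs.

Theorem theorem6p4 (R : realType) (n : nat) (n_ge2 : (2 <= n)%N)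
  (D K : set (Cspace R n)) (domD : domain D)
  (compactK : compact K) (subKD : K `<=` D) (connDK : connected (D `\` K))
  (f : 'rV[oct R]_n -> oct R) (srf : slice_regular (D `\` K) f) :
  exists g : 'rV[oct R]_n -> oct R,
    slice_regular D g /\ forall x, Omega (D `\` K) x -> g x = f x.
Proof.
have [_ oD _] := domD.
(* [cutoff] requires a point of [K]; when there is none, [f] is its own extension. *)
have [K0|/set0P K0] := eqVneq K set0.
  by exists f; split => //; move: srf; rewrite K0 setD0.
have [F [sF holF indF]] := srf.
have clK : closed K by apply: compact_closed => //; exact: norm_hausdorff.
have oDK : open (D `\` K) by rewrite setDE; apply: openI => //; exact: closed_openC.
have hF := (holomorphic_onP F oDK).1 holF.
have [G [sG hG] [V [oV V0 VDK GF]]] :=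
  hartogs_symmetric n_ge2 oD compactK subKD K0 sF hF.
have hG' : holv (D `\` K) (fun z => (G z).1) (fun z => (G z).2).
  have [C1 C2 CR] := hG.
  by split=> [t v tv z [Dz _]|t v tv z [Dz _]|t z [Dz _]];
    [exact: C1 tv z Dz|exact: C2 tv z Dz|exact: CR].
have GFV z : V z -> (G z).1 = (F z).1 /\ (G z).2 = (F z).2 by move=> /GF ->.
(* Connectedness of D minus K enters here: agreement on [V] spreads to all of it. *)
have GFDK := determined_oct oDK connDK oV V0 VDK hG' hF GFV.
have [g gG] := slice_exists sG.
exists g; split.
  by exists G; split => //; exact: (holomorphic_onP G oD).2 hG.
move=> x [J [z [SJ Dz ->]]].
have [e1 e2] := GFDK z Dz.
by rewrite gG ?indF// ?e1 ?e2//; case: Dz.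
Qed.
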